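(* Let $X$ be a paracompact Hausdorff space. The following are equivalent: (a) $X$ is a finite $C$-space. (b) For each aspherical sequence $\varphi_k:X\leadsto Y$, $k<\omega$, of lower locally constant mappings in a Hausdorff space $Y$, there exists $n<\omega$ such that $\varphi_n$ has a continuous selection. (c) Each sequence $\mathscr{U}_k$, $k<\omega$, of open covers of $X$ admits a canonical map $f:X\to|\Delta(\mathscr{U}_{\leq n})|$ for some $n<\omega$.
   Context: Finite $C$-space: a normal space $X$ is a finite $C$-space if for any sequence $\{\mathscr{U}_k:k<\omega\}$ of finite open covers of $X$ there exist $n<\omega$ and a finite sequence $\{\mathscr{V}_k:k\leq n\}$ of pairwise-disjoint families of open subsets of $X$ such that each $\mathscr{V}_k$ refines $\mathscr{U}_k$ (every member of $\mathscr{V}_k$ is contained in some member of $\mathscr{U}_k$) and $\bigcup_{k\leq n}\mathscr{V}_k$ covers $X$. Set-valued mappings: $\Phi:X\leadsto Y$ is a map from $X$ to the nonempty subsets of $Y$; $f:X\to Y$ is a selection for $\Phi$ if $f(x)\in\Phi(x)$ for all $x$; $\Phi$ is lower locally constant if $\{x\in X:K\subset\Phi(x)\}$ is open in $X$ for every compact $K\subset Y$. For $S,B\subset Y$ and $k\ge0$, $S\stackrel{k}{\hookrightarrow}B$ means every continuous map from the $k$-sphere to $S$ extends to a continuous map from the $(k+1)$-ball to $B$; $\varphi\stackrel{k}{\hookrightarrow}\psi$ means $\varphi(x)\stackrel{k}{\hookrightarrow}\psi(x)$ for all $x\in X$. The sequence $\varphi_k$, $k<\omega$, is aspherical if $\varphi_k\stackrel{k}{\hookrightarrow}\varphi_{k+1}$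 for every $k<\omega$. Simplicial complexes: a simplicial complex is a collection $\Sigma$ of nonempty finite sets closed under taking nonempty subsets. Embedding the vertices as a linearly independent subset of a normed linear space, $|\sigma|$ is the convex hull of $\sigma\in\Sigma$, and $|\Sigma|=\bigcup_{\sigma\in\Sigma}|\sigma|$ is the geometric realisation with the Whitehead topology ($U$ is open iff $U\cap|\sigma|$ is open in $|\sigma|$ for every $\sigma\in\Sigma$). $\langle\sigma\rangle$ is the relative interior of $|\sigma|$, and $\mathrm{st}\langle v\rangle=\bigcup_{v\in\sigma\in\Sigma}\langle\sigma\rangle$ is the open star of a vertex $v$. $\Delta(\mathscr{U}_{\leq n})$: regard the disjoint union $\bigcup_{k\leq n}\mathscr{U}_k\times\{k\}$ as an indexed cover of $X$, the index $(U,k)$ representing the set $U$. For a nonempty finite set $\sigma$ of indices, $\ker[\sigma]=\bigcap_{(U,k)\in\sigma}U$. The nerve $\mathscr{N}(\mathscr{U}_{\leq n})$ consists of all such $\sigma$ with $\ker[\sigma]\ne\varnothing$, and $\Delta(\mathscr{U}_{\leq n})$ is the subcomplex of those $\sigma$ containing at most one element of $\mathscr{U}_k\times\{k\}$ for each $k\leq n$. Canonical map: a continuous map $f:X\to|\Delta(\mathscr{U}_{\leq n})|$ is canonical if $f^{-1}(\mathrm{st}\langle(U,k)\rangle)\subset U$ for every vertex $(U,k)$. *)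

(* Defs.v *)
From HB Require Import structures.
From mathcomp Require Import all_boot all_order all_algebra.
From mathcomp Require Import all_classical all_reals all_analysis.

Set Implicit Arguments.
Unset Strict Implicit.
Unset Printing Implicit Defensive.

Import Order.TTheory GRing.Theory Num.Theory.
Import numFieldNormedType.Exports.

Local Open Scope classical_set_scope.
Local Open Scope ring_scope.

Section covers.
Variable X : topologicalType.
Implicit Types U V : set (set X).

Definition open_family U := forall A, U A -> open A.

Definition open_cover U := open_family U /\ \bigcup_(A in U) A = [set: X].

Definition refines V U := forall A, V A -> exists2 B, U B & A `<=` B.

Definition locally_finite V := forall x : X,
  exists2 O, nbhs x O & finite_set [set A | V A /\ A `&` O !=set0].

End covers.

Definition paracompact (X : topologicalType) :=
  forall U : set (set X), open_cover U ->
    exists V, [/\ open_cover V, refines V U & locally_finite V].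

Definition finite_C_space (X : topologicalType) :=
  normal_space X /\
  forall U : nat -> set (set X),
    (forall k, open_cover (U k) /\ finite_set (U k)) ->
    exists (n : nat) (V : nat -> set (set X)),
      (forall k, (k <= n)%N ->
        [/\ open_family (V k), trivIset (V k) id & refines (V k) (U k)]) /\
      \bigcup_(k in [set k | (k <= n)%N]) \bigcup_(A in V k) A = [set: X].

Section set_valued.
Variables X Y : topologicalType.

Definition lower_locally_constant (Phi : X -> set Y) :=
  forall K : set Y, compact K -> open [set x | K `<=` Phi x].

Definition selection (Phi : X -> set Y) (f : X -> Y) := forall x, Phi x (f x).

Variable R : realType.

(* The Euclidean norm is spelled out: the library norm on 'rV[R]_n is the
   sup norm. *)
Definition sphere (k : nat) : set 'rV[R]_k.+1 :=
  [set x | \sum_(i < k.+1) x 0 i ^+ 2 = 1].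

Definition solid_ball (k : nat) : set 'rV[R]_k.+1 :=
  [set x | \sum_(i < k.+1) x 0 i ^+ 2 <= 1].

Arguments sphere : clear implicits.
Arguments solid_ball : clear implicits.

(* The k-sphere and the (k+1)-ball both live in R^(k+1).  A map from the
   sphere is represented by a total function of which only the restriction to
   the sphere matters. *)
Definition sphere_extends (k : nat) (S B : set Y) :=
  forall g : 'rV[R]_k.+1 -> Y,
    {within sphere k, continuous g} -> g @` sphere k `<=` S ->
    exists h : 'rV[R]_k.+1 -> Y,
      [/\ {within solid_ball k, continuous h},
          h @` solid_ball k `<=` B &
          forall x, sphere k x -> h x = g x].

Definition aspherical (phi : nat -> X -> set Y) :=
  forall k x, sphere_extends k (phi k x) (phi k.+1 x).

End set_valued.
Arguments aspherical {X Y} R phi.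

Record complex (V : Type) := Complex {
  simplices : set (set V);
  simplex_finite : forall s, simplices s -> finite_set s;
  simplex_neq0 : forall s, simplices s -> s !=set0;
  simplex_sub : forall s t, simplices s -> t `<=` s -> t !=set0 -> simplices t }.

Section hulls.
Variables (R : realType) (E : normedModType R).
Implicit Type A : set E.

Definition convex_hull A : set E := [set x |
  exists (m : nat) (t : 'I_m -> R) (a : 'I_m -> E),
    [/\ forall i, 0 <= t i, \sum_i t i = 1, forall i, A (a i) &
        x = \sum_i t i *: a i]].

Definition affine_hull A : set E := [set x |
  exists (m : nat) (t : 'I_m -> R) (a : 'I_m -> E),
    [/\ \sum_i t i = 1, forall i, A (a i) & x = \sum_i t i *: a i]].

Definition relative_interior A : set E :=
  [set x | A x /\ \forall y \near x, affine_hull A y -> A y].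

End hulls.

(* Geometric realisation relative to a placement e of the vertices in a normed
   space; it is meant for e injective with linearly independent range. *)
Section realisation.
Variables (R : realType) (E : normedModType R) (V : Type) (e : V -> E).

Definition closed_simplex (s : set V) : set E := convex_hull (e @` s).

Definition open_simplex (s : set V) : set E :=
  relative_interior (closed_simplex s).

Definition polyhedron (K : complex V) : set E :=
  \bigcup_(s in simplices K) closed_simplex s.

Definition open_star (K : complex V) (v : V) : set E :=
  \bigcup_(s in [set s | simplices K s /\ s v]) open_simplex s.

Definition realisation (K : complex V) : Type := {x : E | polyhedron K x}.

Definition realisation_val (K : complex V) (x : realisation K) : E := sval x.

HB.instance Definition _ (K : complex V) :=
  gen_eqMixin (realisation K).
HB.instance Definition _ (K : complex V) :=
  gen_choiceMixin (realisation K).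

Definition whitehead_open (K : complex V) : set (set (realisation K)) :=
  [set U | forall s, simplices K s -> exists2 W : set E, open W &
    U `&` @realisation_val K @^-1` closed_simplex s =
    @realisation_val K @^-1` (W `&` closed_simplex s)].

Lemma whitehead_openT (K : complex V) : whitehead_open [set: realisation K].
Proof. by move=> s _; exists setT; [exact: openT | rewrite !setTI]. Qed.

Lemma whitehead_openI (K : complex V) : setI_closed (@whitehead_open K).
Proof.
move=> A B oA oB s Ks.
have [W1 oW1 e1] := oA s Ks; have [W2 oW2 e2] := oB s Ks.
exists (W1 `&` W2); first exact: openI.
rewrite -{1}(setIid (_ @^-1` closed_simplex s)) setIACA e1 e2.
by rewrite -preimage_setI setIACA setIid.
Qed.

Lemma whitehead_open_bigU (K : complex V) (I : Type)
    (f : I -> set (realisation K)) :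
  (forall i, whitehead_open (f i)) -> whitehead_open (\bigcup_i f i).
Proof.
move=> of_ s Ks.
have [W HW] := choice (fun i => (let: ex_intro2 W a b := of_ i s Ks in
  ex_intro (fun W => open W /\ _ = _ @^-1` (W `&` closed_simplex s)) W (conj a b))).
exists (\bigcup_i W i); first by apply: bigcup_open => i _; case: (HW i).
rewrite !setI_bigcupl preimage_bigcup.
by apply: eq_bigcupr => i _; case: (HW i).
Qed.

HB.instance Definition _ (K : complex V) :=
  isOpenTopological.Build (realisation K) (@whitehead_openT K)
    (@whitehead_openI K) (@whitehead_open_bigU K).

End realisation.

(* The normed space of finitely supported functions V -> R with the
   l1 norm; the vertex v is placed at the indicator function of v. *)
Section free_space.
Variables (R : realType) (V : choiceType).

Definition finsupp : {pred V -> R} :=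
  fun f => `[< finite_set [set v | f v != 0] >].

Lemma finsuppP (f : V -> R) :
  reflect (finite_set [set v | f v != 0]) (f \in finsupp).
Proof. exact: asboolP. Qed.

Lemma finsupp_submod : submod_closed finsupp.
Proof.
split=> [|a f g /finsuppP ff /finsuppP fg]; apply/finsuppP.
  apply: (@sub_finite_set _ _ set0) => // v /=; by rewrite eqxx.
apply: (@sub_finite_set _ _ ([set v | f v != 0] `|` [set v | g v != 0])).
  move=> v /= /eqP H; have [f0|?] := eqVneq (f v) 0; last by left.
  right; apply/eqP => g0; apply: H.
  suff: a * f v + g v = 0 by [].
  by rewrite f0 g0 mulr0 addr0.
by rewrite finite_setU.
Qed.

HB.instance Definition _ :=
  GRing.isSubmodClosed.Build R (V -> R) finsupp finsupp_submod.

Record free_space := FreeSpace {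
  free_val :> V -> R;
  free_valP : free_val \in finsupp }.

HB.instance Definition _ := [isSub for free_val].
HB.instance Definition _ := [Choice of free_space by <:].
HB.instance Definition _ := [SubChoice_isSubLmodule of free_space by <:].

Definition free_norm (f : free_space) : R := \sum_(v \in [set: V]) `|f v|.

Lemma free_normE (f : free_space) (A : set V) : finite_set A ->
  [set v | f v != 0] `<=` A -> free_norm f = \sum_(v \in A) `|f v|.
Proof.
move=> finA fA; rewrite /free_norm; symmetry.
apply: fsbig_widen => // v [_ /= nAv].
by apply/eqP; rewrite normr_eq0; apply: contrapT => /negP /fA.
Qed.

Lemma free_norm_triangle (f g : free_space) :
  free_norm (f + g) <= free_norm f + free_norm g.
Proof.
have /finsuppP ff := free_valP f; have /finsuppP fg := free_valP g.
set A := [set v | f v != 0] `|` [set v | g v != 0].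
have fA : finite_set A by rewrite finite_setU.
rewrite (@free_normE f A)//; last by move=> v ?; left.
rewrite (@free_normE g A)//; last by move=> v ?; right.
rewrite (@free_normE (f + g) A)//; last first.
  move=> v /= /eqP H; have [f0|?] := eqVneq (f v) 0; last by left.
  right; apply/eqP => g0; apply: H; suff: f v + g v = 0 by [].
  by rewrite f0 g0 addr0.
rewrite !fsbig_finite//= -big_split/=.
by apply: ler_sum => v _; exact: ler_normD.
Qed.

Lemma free_normZ (a : R) (f : free_space) :
  free_norm (a *: f) = `|a| * free_norm f.
Proof.
have /finsuppP ff := free_valP f.
rewrite (@free_normE f [set v | f v != 0])//.
rewrite (@free_normE (a *: f) [set v | f v != 0])//; last first.
  move=> v /= /eqP H; apply/eqP => f0; apply: H.
  by suff: a * f v = 0 by []; rewrite f0 mulr0.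
rewrite !fsbig_finite//= big_distrr/=.
by apply: eq_bigr => v _; rewrite -normrM.
Qed.

Lemma free_norm_eq0 (f : free_space) : free_norm f = 0 -> f = 0.
Proof.
have /finsuppP ff := free_valP f.
rewrite (@free_normE f [set v | f v != 0])// fsbig_finite//= => /eqP.
rewrite psumr_eq0// => /allP H; apply: val_inj; apply/funext => v.
have [//|fv] := eqVneq (f v) 0.
have := H v; rewrite in_fset_set// inE => /(_ fv) /=.
by rewrite normr_eq0 (negPf fv).
Qed.

HB.instance Definition _ :=
  Lmodule_isNormed.Build R free_space free_norm_triangle free_normZ
    free_norm_eq0.

Lemma vertex_subproof (v : V) :
  (fun w => (w == v)%:R : R) \in finsupp.
Proof.
apply/finsuppP; apply: (@sub_finite_set _ _ [set v]) => // w /=.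
by case: (w =P v) => // _; rewrite eqxx.
Qed.

Definition vertex (v : V) : free_space := FreeSpace (vertex_subproof v).

Lemma vertex_linearly_independent (m : nat) (t : 'I_m -> R) (a : 'I_m -> V) :
  injective a -> \sum_i t i *: vertex (a i) = 0 -> forall i, t i = 0.
Proof.
move=> inj_a s0 i.
have evalE (r : seq 'I_m) : (\sum_(j <- r) t j *: vertex (a j) : free_space)
    (a i) = \sum_(j <- r) t j * (a i == a j)%:R.
  elim: r => [|j r IH]; first by rewrite !big_nil.
  by rewrite !big_cons -IH.
have := evalE (index_enum 'I_m).
rewrite s0 (bigD1 i)//= eqxx mulr1 big1 ?addr0 => [<-//|j ji].
by rewrite (inj_eq inj_a) eq_sym (negPf ji) mulr0.
Qed.

End free_space.

Section nerve.
Variables (X : topologicalType) (U : nat -> set (set X)) (n : nat).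

(* The index (A, k) stands for A as a member of the k-th cover. *)
Local Notation cover_index := (set X * nat)%type.

Definition is_index (i : cover_index) := U i.2 i.1 /\ (i.2 <= n)%N.

Definition cover_kernel (s : set cover_index) : set X := \bigcap_(i in s) i.1.

Definition nerve_simplices : set (set cover_index) := [set s |
  [/\ finite_set s, s !=set0, s `<=` is_index & cover_kernel s !=set0]].

Definition delta_simplices : set (set cover_index) := [set s |
  nerve_simplices s /\ forall i j, s i -> s j -> i.2 = j.2 -> i = j].

Lemma delta_finite s : delta_simplices s -> finite_set s.
Proof. by case=> -[]. Qed.

Lemma delta_neq0 s : delta_simplices s -> s !=set0.
Proof. by case=> -[]. Qed.

Lemma delta_sub s t :
  delta_simplices s -> t `<=` s -> t !=set0 -> delta_simplices t.
Proof.
move=> [[fs _ si [x kx]] s1] ts t0; split; last first.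
  by move=> i j /ts si' /ts sj'; exact: s1.
split=> //; first exact: sub_finite_set fs.
  by move=> i /ts /si.
by exists x => i /ts; exact: kx.
Qed.

Definition Delta : complex cover_index :=
  Complex delta_finite delta_neq0 delta_sub.

End nerve.

Definition Delta_space (R : realType) (X : topologicalType)
    (U : nat -> set (set X)) (n : nat) : topologicalType :=
  realisation (@vertex R (set X * nat)%type) (Delta U n).

Definition canonical_map (R : realType) (X : topologicalType)
    (U : nat -> set (set X)) (n : nat) (f : X -> Delta_space R U n) :=
  continuous f /\
  forall i : set X * nat, simplices (Delta U n) [set i] ->
    (fun x => realisation_val (f x)) @^-1`
      open_star (@vertex R (set X * nat)%type) (Delta U n) i `<=` i.1.

(* Main.v *)
Require Import Defs.
From HB Require Import structures.
From mathcomp Require Import all_boot all_order all_algebra.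
From mathcomp Require Import finmap.
From mathcomp Require Import all_classical all_reals all_analysis.
From mathcomp Require Import ring lra.

Set Implicit Arguments.
Unset Strict Implicit.
Unset Printing Implicit Defensive.

Import Order.TTheory GRing.Theory Num.Theory.
Import numFieldNormedType.Exports.

Local Open Scope classical_set_scope.
Local Open Scope ring_scope.

(** The key step is that a paracompact finite C-space has the defining property
   for arbitrary open covers. Call a closed set D finite dimensional if, for
   some n, any n two-element covers of D have disjoint open refinements which
   together cover D. Along a discrete family of closed sets these dimensions
   are bounded: otherwise two-element covers witnessing the failure glue to
   covers with three elements, contradicting the C-property. Hence every
   continuous real function is bounded on the set K of points without finite
   dimensional neighbourhood, so every open cover is refined around K by
   finitely many disjoint families, which are fed to the C-property as a finite
   cover; the closed rest misses K, is finite dimensional, and is exhausted by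
   finitely many further covers.

   For (a) => (b) and (a) => (c), the resulting disjoint families carry a
   partition of unity mapping X into the simplices spanned by them. Covers are
   chosen inductively together with a map of these simplices to Y: a new vertex
   is coned off by asphericity, and lower local constancy makes the cone valid
   on a neighbourhood. For (b) => (a), apply (b) to the sets of points of the
   simplices through x. For (c) => (a), pull back the open stars. *)

(** * Paracompact Hausdorff spaces *)

(** Condition (a) gives control over finite covers only, whereas (b) and (c) lead to arbitrary ones.
    The test covers in the definition of dimension have two elements because covers of the pieces of
    a discrete family are merged member by member, and the merged cover is finite only when the
    number of members is the same on all pieces. What a dimension bound [n] buys is uniformity: on a
    set of that dimension every finite cover, however large, can be shrunk to order [n]. A
    barycentric refinement, whose sets with index sets of one cardinality are disjoint, turns this
    order into a number of disjoint families. Unbounded order is met by cutting the set into rings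
    on which it is bounded; rings of the same parity are glued, which works because the number of
    families is the same on every ring. In (a) => (b) the length [n] is known only once all covers
    are given, while each cover depends on the map built so far; so an infinite sequence of covers
    and maps is constructed before the C-property is applied. *)

Definition locally_finite_indexed (X : topologicalType) (I : Type)
    (F : I -> set X) :=
  forall x : X, exists2 O, nbhs x O & finite_set [set i | F i `&` O !=set0].

Lemma closure_bigcup_locally_finite (X : topologicalType) (I : choiceType)
    (D : set I) (F : I -> set X) : locally_finite_indexed F ->
  closure (\bigcup_(i in D) F i) `<=` \bigcup_(i in D) closure (F i).
Proof.
move=> lfF x clx; apply: contrapT => nx.
have [N nN finN] := lfF x.
pose J := fset_set [set i | F i `&` N !=set0].
have : nbhs x (N `&` \bigcap_(i in [set` J]) [set y | D i -> ~ F i y]).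
  apply: filterI => //; apply: filter_bigI => i _.
  have [Di|nDi] := pselect (D i); last by apply: filterS filterT => y _ /nDi.
  have : ~ closure (F i) x by move=> ?; apply: nx; exists i.
  rewrite -[X in ~ X]/((closure (F i)) x) => /existsNP[P /not_implyP[nP eP]].
  apply: filterS nP => y Py _ Fy; apply: eP; by exists y.
move=> /clx[y [[i Di Fiy] [Oy /(_ i) H]]].
apply: H => //=; rewrite in_fset_set // inE; by exists y.
Qed.

Section paracompact_hausdorff.
Variable X : topologicalType.
Hypothesis pcX : paracompact X.

(** Members of a locally finite refinement are merged along a choice of index. A neighbourhood
    meeting finitely many members meets finitely many merged ones, so local finiteness survives. *)
Lemma paracompact_indexed (I : choiceType) (W : I -> set X) :
  (forall i, open (W i)) -> (forall x, exists i, W i x) ->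
  exists G : I -> set X, [/\ forall i, open (G i), forall i, G i `<=` W i,
    forall x, exists i, G i x & locally_finite_indexed G].
Proof.
move=> oW cW.
have [|V [[oV cV] refV lfV]] := pcX (U := range W).
  split; first by move=> _ [i _ <-].
  apply/seteqP; split=> // x _; have [i Wx] := cW x.
  by exists (W i) => //; exists i.
(* [option] provides a value for sets outside [V], as [I] comes without a default element. *)
have /choice[r Hr] : forall A, exists o : option I,
    V A -> exists2 i, o = Some i & A `<=` W i.
  move=> A.
  have [VA|nVA] := pselect (V A); last by exists None.
  have [_ [i _ <-] AW] := refV A VA; by exists (Some i) => _; exists i.
exists (fun i => \bigcup_(A in [set A | V A /\ r A = Some i]) A); split.
- by move=> i; apply: bigcup_open => A [/oV].
- move=> i x [A [VA rA] Ax]; have [j] := Hr A VA.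
  by rewrite rA => -[<-]; apply.
- move=> x; have : setT x by [].
  rewrite -cV => -[A VA Ax]; have [i rA _] := Hr A VA.
  by exists i, A.
- move=> x; have [N nN finN] := lfV x; exists N => //.
  apply: (@sub_finite_set _ _
    (Some @^-1` (r @` [set A | V A /\ A `&` N !=set0]))).
    by move=> i [y [[A [VA rA] Ay] Oy]] /=; exists A => //; split=> //; exists y.
  apply: finite_preimage; first by move=> i j _ _ [].
  exact: finite_image.
Qed.

(** Regularity ([A] a point) and normality ([A] closed) are both instances. Points outside [B]
    receive the complement of [B] as neighbourhood, so a refining set that meets [B] has its index
    in [B]; the closures of these sets avoid [A], and by local finiteness so does the closure of
    their union. *)
Lemma paracompact_separation (A B : set X) : closed B ->
  (forall y, B y -> exists P, [/\ open P, P y & closure P `&` A = set0]) ->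
  exists Q, [/\ open Q, B `<=` Q & closure Q `&` A = set0].
Proof.
move=> cB sepB.
have /choice[W HW] : forall y, exists P, [/\ open P, P y &
    if y \in B then closure P `&` A = set0 else P = ~` B].
  move=> y; have [/set_mem /sepB //|/negP yB] := boolP (y \in B).
  exists (~` B); split=> //; first exact: closed_openC.
  by move=> By; apply: yB; rewrite inE.
have [|y|G [oG GW cG lfG]] := @paracompact_indexed X W.
- by move=> y; case: (HW y).
- by exists y; case: (HW y).
exists (\bigcup_(y in B) G y); split.
- by apply: bigcup_open => y _.
- move=> y By; have [z Gz] := cG y; exists z => //.
  have [_ _] := HW z; case: ifPn => [/set_mem //|_ WB].
  by have := GW _ _ Gz; rewrite WB.
- rewrite -subset0 => x [/(closure_bigcup_locally_finite lfG)[y By cly] Ax].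
  have [_ _] := HW y; rewrite mem_set // => <-; split; last exact: Ax.
  exact: closureS cly.
Qed.

Hypothesis hdX : hausdorff_space X.

Lemma paracompact_regular (x : X) (B : set X) : closed B -> ~ B x ->
  exists Q, [/\ open Q, B `<=` Q & ~ closure Q x].
Proof.
move=> cB nBx; have [|Q [oQ BQ Qx]] := @paracompact_separation [set x] B cB.
  move=> y By; have xy : y != x by apply/eqP => yx; apply: nBx; rewrite -yx.
  move: hdX; rewrite open_hausdorff => /(_ _ _ xy)[[P Q] /= [Py Qx] [oP oQ PQ]].
  exists P; split; [by []|by rewrite inE in Py|rewrite -subset0 => z [clz /= zx]].
  rewrite inE in Qx; rewrite -zx in Qx.
  have [t [Pt Qt]] : P `&` Q !=set0 by apply: clz; exact: open_nbhs_nbhs.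
  by move/eqP: PQ => /seteqP[/(_ t)] PQ _; apply: PQ.
exists Q; split=> // clx; have : (closure Q `&` [set x]) x by [].
by rewrite Qx.
Qed.

Lemma paracompact_normal (A B : set X) : closed A -> closed B ->
  A `&` B = set0 -> exists Q, [/\ open Q, B `<=` Q & closure Q `&` A = set0].
Proof.
move=> cA cB AB; apply: paracompact_separation => // y By.
have nAy : ~ A y by move=> Ay; have : (A `&` B) y by []; rewrite AB.
have [Q [oQ AQ nQy]] := paracompact_regular cA nAy.
exists (~` closure Q); split=> //.
  by rewrite openC; exact: closed_closure.
rewrite -subset0 => z [clz Az].
have [t [/= nt Qt]] : ~` closure Q `&` Q !=set0.
  by apply: clz; apply: open_nbhs_nbhs; split=> //; exact: AQ.
by apply: nt; exact: subset_closure.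
Qed.

Lemma paracompact_normal_space (R : realType) : normal_space X.
Proof.
apply: (proj2 (@normal_openP R X)) => A B cA cB AB.
have [Q [oQ BQ QA]] := paracompact_normal cA cB AB.
exists (~` closure Q), Q; split=> //.
- by rewrite openC; exact: closed_closure.
- by move=> x Ax clx; have : (closure Q `&` A) x by []; rewrite QA.
- by rewrite -subset0 => x [/= nx Qx]; apply: nx; exact: subset_closure.
Qed.

(** Regularity gives each [x] an open set with closure inside one chosen [W (r x)]. A locally finite
    refinement of these is merged along [r], and closures commute with locally finite unions. *)
Lemma paracompact_shrinking (I : choiceType) (W : I -> set X) :
  (forall i, open (W i)) -> (forall x, exists i, W i x) ->
  exists G : I -> set X, [/\ forall i, open (G i),
    forall i, closure (G i) `<=` W i, forall x, exists i, G i x &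
    locally_finite_indexed G].
Proof.
move=> oW cW; have [r Hr] := choice cW.
have /choice[P HP] : forall x, exists P, [/\ open P, P x & closure P `<=` W (r x)].
  move=> x; have [||Q [oQ WQ nQx]] := @paracompact_regular x (~` W (r x)).
  - by rewrite closedC.
  - by move/(_ (Hr x)).
  exists (~` closure Q); split=> //; first by rewrite openC; exact: closed_closure.
  move=> z clz; apply: contrapT => nW; have [t [/= nt Qt]] : ~` closure Q `&` Q !=set0.
    by apply: clz; apply: open_nbhs_nbhs; split=> //; exact: WQ.
  by apply: nt; exact: subset_closure.
have [|x|G [oG GP cG lfG]] := @paracompact_indexed X P.
- by move=> x; case: (HP x).
- by exists x; case: (HP x).
exists (fun i => \bigcup_(x in r @^-1` [set i]) G x); split.
- by move=> i; apply: bigcup_open => x _.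
- move=> i x /(closure_bigcup_locally_finite lfG)[y <- cly].
  by have [_ _] := HP y; apply; exact: closureS cly.
- by move=> x; have [y Gy] := cG x; exists (r y), y.
- move=> x; have [N nN finN] := lfG x; exists N => //.
  apply: (sub_finite_set _ (finite_image r finN)).
  by move=> i [y [[z <- Gz] Oy]]; exists z => //; exists y.
Qed.

End paracompact_hausdorff.

Lemma continuous_near_eq (X Y : topologicalType) (f g : X -> Y) (x : X) :
  (\near x, f x = g x) -> {for x, continuous g} -> {for x, continuous f}.
Proof.
move=> fg cg; rewrite /continuous_at /prop_for (nbhs_singleton fg).
apply: cvg_trans cg; apply: near_eq_cvg.
by apply: filterS fg => y ->.
Qed.

Lemma continuous_locally_finite_sum (R : realType) (X : topologicalType)
    (I : choiceType) (u : I -> X -> R) : (forall i, continuous (u i)) ->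
  locally_finite_indexed (fun i => [set x | u i x != 0]) ->
  continuous (fun x => \sum_(i \in [set: I]) u i x).
Proof.
move=> cu lfu x; have [N nN finN] := lfu x.
apply: (@continuous_near_eq _ _ _ (fun y => \sum_(i <- fset_set
  [set i | [set x | u i x != 0] `&` N !=set0]) u i y)); last first.
  by apply: continuous_big => // ; exact: add_continuous.
apply: filterS nN => y Ny; rewrite -fsbig_finite //; symmetry.
apply: fsbig_widen => // i [_ /= nu]; apply/eqP; apply: contrapT => /negP u0.
by apply: nu; exists y.
Qed.

(** * Partitions of unity and barycentric refinements *)

Section barycentric.
Variables (R : realType) (X : topologicalType).
Hypotheses (pcX : paracompact X) (hdX : hausdorff_space X).

(** The functions are left unnormalised so that their maximum at each point is 1 and is attained,
    which the barycentric refinement relies on. Of the two shrinkings, [G] makes the supports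
    locally finite and [H] is a cover on whose members the functions are 1. *)
Lemma urysohn_partition (I : choiceType) (W : I -> set X) :
  (forall i, open (W i)) -> (forall x, exists i, W i x) ->
  exists u : I -> X -> R, [/\ forall i, continuous (u i),
    forall i x, 0 <= u i x <= 1, forall i x, u i x != 0 -> W i x,
    locally_finite_indexed (fun i => [set x | u i x != 0]) &
    forall x, exists i, u i x = 1].
Proof.
move=> oW cW.
have [G [oG GW cG lfG]] := paracompact_shrinking pcX hdX oW cW.
have [H [oH HG cH lfH]] := paracompact_shrinking pcX hdX oG cG.
have /choice[u Hu] : forall i, exists f : X -> R, [/\ continuous f,
    forall x, 0 <= f x <= 1, forall x, ~ G i x -> f x = 0 &
    forall x, H i x -> f x = 1].
  move=> i; have /(@uniform_separatorP _ R)[f [cf f01 f0 f1]] :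
      uniform_separator (~` G i) (closure (H i)).
    apply: (proj1 (@normal_separatorP R X) (paracompact_normal_space pcX hdX R)).
    - by rewrite closedC.
    - exact: closed_closure.
    - by rewrite -subset0 => x [nG /HG].
  exists f; split=> // x.
  - by have := f01 (f x); rewrite /= in_itv /=; apply; exists x.
  - by move=> nG; apply: f0; exists x.
  - by move=> Hx; apply: f1; exists x => //; exact: subset_closure.
have uG i x : u i x != 0 -> G i x.
  move=> u0; apply: contrapT => nG; have [_ _ /(_ x nG) ux _] := Hu i.
  by rewrite ux eqxx in u0.
exists u; split.
- by move=> i; have [] := Hu i.
- by move=> i; have [] := Hu i.
- by move=> i x /uG /subset_closure /GW.
- move=> x; have [N nN finN] := lfG x; exists N => //.
  by apply: (sub_finite_set _ finN) => i [y [/uG Gy Ny]]; exists y.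
- by move=> x; have [i Hx] := cH x; exists i; have [_ _ _] := Hu i; exact.
Qed.

(* [V s] consists of the points at which the functions with index in [s]
   strictly dominate the others; [phi], the sum of all of them, bounds the
   number of those which attain the maximal value 1. *)
Lemma barycentric_refinement (I : choiceType) (W : I -> set X) :
  (forall i, open (W i)) -> (forall x, exists i, W i x) ->
  exists (phi : X -> R) (V : {fset I} -> set X), [/\ continuous phi,
    forall s, open (V s),
    forall s t : {fset I}, #|` s| = #|` t| -> V s `&` V t !=set0 -> s = t,
    forall (s : {fset I}) i, i \in s -> V s `<=` W i &
    forall x, exists s : {fset I}, [/\ V s x, (0 < #|` s|)%N & #|` s|%:R <= phi x]].
Proof.
move=> oW cW; have [u [cu u01 uW lfu u1]] := urysohn_partition oW cW.
pose V (s : {fset I}) := [set x | forall i, i \in s -> 0 < u i x /\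
  forall j, j \notin s -> u j x < u i x].
exists (fun x => \sum_(i \in [set: I]) u i x), V; split.
- exact: continuous_locally_finite_sum.
- move=> s; rewrite openE => x Vx.
  have [N nN finN] := lfu x.
  (* Only the finitely many indices in [J] can be non-zero on [N]; the others are dominated as soon
     as [u i] is positive. *)
  pose J := fset_set [set i | [set x | u i x != 0] `&` N !=set0].
  have : nbhs x (N `&` (\bigcap_(i in [set` s]) [set y | 0 < u i y] `&`
      \bigcap_(i in [set` s]) \bigcap_(j in [set` (J `\` s)%fset])
        [set y | 0 < u i y - u j y])).
    apply: filterI => //; apply: filterI.
      apply: filter_bigI => i /= si; apply: (cvgr_gt _ (cu i x)).
      by have [] := Vx i si.
    apply: filter_bigI => i si; apply: filter_bigI => j; rewrite inE => /andP[sj _].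
    apply: (@cvgr_gt _ _ _ _ (fun y => u i y - u j y) (u i x - u j x)).
      by apply: cvgB; exact: cu.
    by rewrite subr_gt0; have [_] := Vx i si; exact.
  apply: filterS => y [Ny [Hy1 Hy2]] i si; split; first exact: Hy1.
  move=> j sj; have [jJ|jJ] := boolP (j \in J).
    by rewrite -subr_gt0; apply: (Hy2 i si j) => /=; rewrite inE sj.
  have -> : u j y = 0; last exact: Hy1.
  apply/eqP; apply: contraNT jJ => uj; rewrite in_fset_set // inE; by exists y.
- move=> s t st [x [Vs Vt]].
  have [//|nst] := eqVneq s t.
  have [i si ti] : exists2 i, i \in s & i \notin t.
    apply: contrapT => H; move/negP: nst; apply; rewrite eqEfcard st leqnn andbT.
    by apply/fsubsetP => i si; apply: contrapT => /negP ti; apply: H; exists i.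
  have [j tj sj] : exists2 i, i \in t & i \notin s.
    apply: contrapT => H; move/negP: nst; apply.
    rewrite eq_sym eqEfcard st leqnn andbT.
    by apply/fsubsetP => j sj; apply: contrapT => /negP tj; apply: H; exists j.
  (* [u i] exceeds [u j] at [x] on account of [V s], and [u j] exceeds [u i] on account of [V t]. *)
  have [_ /(_ j sj) h1] := Vs i si; have [_ /(_ i ti) h2] := Vt j tj.
  by have := lt_trans h1 h2; rewrite ltxx.
- by move=> s i si x /(_ i si)[u0 _]; apply: uW; rewrite gt_eqF.
- move=> x; have [N nN finN] := lfu x; have Nx := nbhs_singleton nN.
  pose s := fset_set [set i | u i x = 1].
  have finu : finite_set [set i | u i x != 0].
    by apply: (sub_finite_set _ finN) => i ui; exists x.
  have fin1 : finite_set [set i | u i x = 1].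
    by apply: (sub_finite_set _ finu) => i /= ->; exact: oner_neq0.
  have sE i : (i \in s) = (u i x == 1).
    by rewrite in_fset_set //; apply/idP/eqP; rewrite inE.
  exists s; split.
  + move=> i; rewrite sE => /eqP ->; split=> // j; rewrite sE => uj.
    by rewrite lt_neqAle uj; have /andP[] := u01 j x.
  + have [i ui] := u1 x; rewrite cardfs_gt0; apply/fset0Pn; exists i.
    by rewrite sE ui.
  + rewrite -(@fsbig_widen _ _ _ _ [set i | u i x != 0] setT) //; last first.
      by move=> i [_ /= /negP]; rewrite negbK => /eqP.
    rewrite fsbig_finite //= (big_fsetID _ (fun i => i \in s)) /=.
    have -> : [fset i in fset_set [set i | u i x != 0] | i \in s]%fset = s.
      apply/fsetP => i; rewrite !inE /= in_fset_set // andbC.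
      have [|//] := boolP (i \in s); rewrite sE => /eqP ui /=.
      by rewrite mem_set //= ui oner_neq0.
    apply: (@le_trans _ _ (\sum_(i <- s) u i x)); last first.
      by rewrite lerDl; apply: sumr_ge0 => i _; have /andP[] := u01 i x.
    rewrite (eq_big_seq (fun=> 1)); last by move=> i; rewrite sE => /eqP.
    by rewrite big_const_seq count_predT iter_addr addr0 lexx.
Qed.
End barycentric.

(** * Dimension by partitions in finite C-spaces *)

(* For a closed subset [D] of a normal space this means that the covering
   dimension of [D] is less than [n], by the theorem on partitions. *)
Definition partition_dim_lt (X : topologicalType) (n : nat) (D : set X) :=
  forall A B : nat -> set X,
    (forall i, [/\ open (A i), open (B i) & D `<=` A i `|` B i]) ->
    exists P Q : nat -> set X,
      (forall i, [/\ open (P i), open (Q i), P i `<=` A i, Q i `<=` B i &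
         P i `&` Q i = set0]) /\
      D `<=` \bigcup_(i in [set i | (i < n)%N]) (P i `|` Q i).

Definition finite_partition_dim (X : topologicalType) (D : set X) :=
  exists n, partition_dim_lt n D.

Section partition_dimension.
Variable X : topologicalType.
Implicit Types C D E F : set X.

Lemma partition_dim_ltW m n D : (m <= n)%N ->
  partition_dim_lt m D -> partition_dim_lt n D.
Proof.
move=> mn SD A B AB; have [P [Q [HPQ DPQ]]] := SD A B AB.
exists P, Q; split=> // x /DPQ[i im PQx]; exists i => //.
exact: leq_trans im mn.
Qed.

(** A cover of [E] becomes a cover of [D] when the complement of [E] is added to each [A i];
    intersecting [P i] with [A i] removes it again. *)
Lemma partition_dim_lt_sub n D E : closed E -> E `<=` D ->
  partition_dim_lt n D -> partition_dim_lt n E.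
Proof.
move=> cE ED SD A B AB.
have [i|P [Q [HPQ DPQ]]] := SD (fun i => A i `|` ~` E) B.
  have [oA oB EAB] := AB i; split=> //.
    by apply: openU => //; rewrite openC.
  move=> x Dx; have [Ex|nEx] := pselect (E x); last by left; right.
  by have [?|?] := EAB x Ex; [left; left|right].
exists (fun i => P i `&` A i), Q; split.
  move=> i; have [oA oB _] := AB i; have [oP oQ PA QB PQ] := HPQ i.
  split=> //; first exact: openI.
  by rewrite setIAC PQ set0I.
move=> x Ex; have [i im [Px|Qx]] := DPQ x (ED x Ex); exists i => //; last by right.
have [_ _ /(_ x Px) PA _ _] := HPQ i.
by left; split=> //; case: PA.
Qed.

Lemma partition_dim_ltU m n D E : partition_dim_lt m D ->
  partition_dim_lt n E -> partition_dim_lt (m + n) (D `|` E).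
Proof.
move=> SD SE A B AB.
have [i|P [Q [HPQ DPQ]]] := SD A B.
  by have [? ? H] := AB i; split=> // x Dx; apply: H; left.
have [i|P' [Q' [HPQ' DPQ']]] := SE (fun i => A (m + i)%N) (fun i => B (m + i)%N).
  by have [? ? H] := AB (m + i)%N; split=> // x Dx; apply: H; right.
exists (fun i => if (i < m)%N then P i else P' (i - m)%N),
  (fun i => if (i < m)%N then Q i else Q' (i - m)%N); split.
  move=> i; case: ltnP => im; first exact: HPQ.
  by have := HPQ' (i - m)%N; rewrite subnKC.
move=> x [/DPQ|/DPQ'] [i /= im PQ].
  by exists i => /=; [exact: leq_trans im (leq_addr _ _)|rewrite im].
exists (m + i)%N => /=; first by rewrite ltn_add2l.
by rewrite ltnNge leq_addr /= addKn.
Qed.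

Lemma finite_partition_dimU D E : finite_partition_dim D ->
  finite_partition_dim E -> finite_partition_dim (D `|` E).
Proof. by move=> [m SD] [n SE]; exists (m + n)%N; exact: partition_dim_ltU. Qed.

Lemma finite_partition_dim0 : finite_partition_dim (set0 : set X).
Proof.
exists 0%N => A B AB; exists (fun=> set0), (fun=> set0); split=> // i.
by split=> //; [exact: open0|exact: open0|rewrite set0I].
Qed.

Lemma finite_partition_dim_bigcup (D : nat -> set X) n :
  (forall i, (i < n)%N -> finite_partition_dim (D i)) ->
  finite_partition_dim (\bigcup_(i in [set i | (i < n)%N]) D i).
Proof.
move=> SD; rewrite bigcup_mkord.
apply: (big_ind (@finite_partition_dim X)); first exact: finite_partition_dim0.
  exact: finite_partition_dimU.
by move=> i _; exact: SD.
Qed.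

(* Disjoint open sets covering the closed set [~` C]; the pieces [G i `\` C]
   then form a discrete family of closed sets. *)
Definition discrete_pieces (I : Type) (G : I -> set X) C :=
  [/\ forall i, open (G i), trivIset setT G, open C &
    forall x, C x \/ exists i, G i x].

Lemma closed_piece (I : choiceType) (G : I -> set X) C i :
  discrete_pieces G C -> closed (G i `\` C).
Proof.
move=> [oG tG oC cG].
have -> : G i `\` C = ~` (C `|` \bigcup_(j in [set j | j != i]) G j).
  apply/seteqP; split=> [x [Gx nC]|x nx].
    case=> [//|[j /eqP ji Gjx]]; apply: ji; apply: tG => //.
    by exists x.
  have nC : ~ C x by move=> Cx; apply: nx; left.
  split=> //; have [//|[j Gjx]] := cG x.
  have [<-//|ji] := eqVneq j i; case: nx; right; by exists j.
rewrite closedC; apply: openU => //; exact: bigcup_open.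
Qed.

(** Solutions on the pieces glue over the disjoint open sets [G i] provided that all have the same
    length [n]; this is why a common bound is wanted. *)
Lemma partition_dim_lt_discrete (I : choiceType) (G : I -> set X) C n :
  discrete_pieces G C -> (forall i, partition_dim_lt n (G i `\` C)) ->
  partition_dim_lt n (~` C).
Proof.
move=> [oG tG oC cG] SG A B AB.
have /choice[PQ HPQ] : forall i, exists PQ : (nat -> set X) * (nat -> set X),
    (forall k, [/\ open (PQ.1 k), open (PQ.2 k), PQ.1 k `<=` A k,
       PQ.2 k `<=` B k & PQ.1 k `&` PQ.2 k = set0]) /\
    G i `\` C `<=` \bigcup_(k in [set k | (k < n)%N]) (PQ.1 k `|` PQ.2 k).
  move=> i; have [k|P [Q HPQ]] := SG i A B; last by exists (P, Q).
  by have [? ? H] := AB k; split=> // x [_ nC]; apply: H.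
exists (fun k => \bigcup_i ((PQ i).1 k `&` G i)),
  (fun k => \bigcup_i ((PQ i).2 k `&` G i)); split.
  move=> k; split.
  - by apply: bigcup_open => i _; apply: openI => //; have [/(_ k)[]] := HPQ i.
  - by apply: bigcup_open => i _; apply: openI => //; have [/(_ k)[]] := HPQ i.
  - by move=> x [i _ [Px _]]; have [/(_ k)[_ _ + _ _] _] := HPQ i; apply.
  - by move=> x [i _ [Qx _]]; have [/(_ k)[_ _ _ + _] _] := HPQ i; apply.
  - rewrite -subset0 => x [[i _ [Px Gi]] [j _ [Qx Gj]]].
    have ij : i = j by apply: tG => //; exists x.
    rewrite -{j}ij in Qx Gj.
    by have [/(_ k)[_ _ _ _ <-] _] := HPQ i.
move=> x nC; have [//|[i Gx]] := cG x.
have [_ /(_ x (conj Gx nC))[k kn [Px|Qx]]] := HPQ i; exists k => //.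
  by left; exists i.
by right; exists i.
Qed.

Hypothesis finC : finite_C_space X.

(** The free function [n] serves two purposes: taken one below the least possible dimension bounds
    it yields a common bound, and taken as the identity on [nat] it finds a finite dimensional piece
    in any sequence of pieces. *)
Lemma finite_C_discrete_pieces (I : choiceType) (G : I -> set X) C (n : I -> nat) :
  discrete_pieces G C ->
  exists N, forall i, (N <= n i)%N -> partition_dim_lt (n i) (G i `\` C).
Proof.
move=> [oG tG oC cG].
(* A sequence of covers whose solution implies the property: a counterexample when the property
   fails, trivial covers when it holds. *)
have /choice[AB HAB] : forall i, exists AB : (nat -> set X) * (nat -> set X),
    (forall k, [/\ open (AB.1 k), open (AB.2 k) &
       G i `\` C `<=` AB.1 k `|` AB.2 k]) /\
    ((exists P Q : nat -> set X,
      (forall k, [/\ open (P k), open (Q k), P k `<=` AB.1 k,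
         Q k `<=` AB.2 k & P k `&` Q k = set0]) /\
      G i `\` C `<=` \bigcup_(k in [set k | (k < n i)%N]) (P k `|` Q k)) ->
    partition_dim_lt (n i) (G i `\` C)).
  move=> i; have [S|] := pselect (partition_dim_lt (n i) (G i `\` C)).
    exists (fun=> setT, fun=> setT); split=> // k.
    by split=> //; [exact: openT|exact: openT|move=> x _; left].
  move=> /existsNP[A /existsNP[B /not_implyP[oAB nAB]]].
  by exists (A, B); split=> //= ?.
pose A k := \bigcup_i ((AB i).1 k `&` G i).
pose B k := \bigcup_i ((AB i).2 k `&` G i).
have oA k : open (A k).
  by apply: bigcup_open => i _; apply: openI => //; have [/(_ k)[]] := HAB i.
have oB k : open (B k).
  by apply: bigcup_open => i _; apply: openI => //; have [/(_ k)[]] := HAB i.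
case: finC => _ /(_ (fun k => C |` (A k |` [set B k]))) [k|m [V [HV cV]]].
  split; last by rewrite !finite_setU; split; [|split]; exact: finite_set1.
  split; first by move=> _ [->|[->|->]].
  apply/seteqP; split=> // x _; have [Cx|nCx] := pselect (C x).
    by exists C => //; left.
  have [//|[i Gx]] := cG x.
  have [/(_ k)[_ _ /(_ x (conj Gx nCx))] + _] := HAB i; case=> ABx.
    by exists (A k); [right; left|exists i].
  by exists (B k); [right; right|exists i].
(* The families 0, ..., [m] are [m.+1] in number, so they fit below [n i]. *)
exists m.+1 => i mi; have [_] := HAB i; apply.
(* Sets of [V k] inside [A k] go to the first side, the remaining ones inside [B k] to the second,
   so disjointness of [V k] separates the sides. Sets inside [C] miss the piece. *)
exists (fun k => if (k <= m)%N
  then \bigcup_(Z in [set Z | V k Z /\ Z `<=` A k]) Z `&` G i else set0).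
exists (fun k => if (k <= m)%N
  then \bigcup_(Z in [set Z | [/\ V k Z, ~ Z `<=` A k & Z `<=` B k]]) Z `&` G i
  else set0).
have AG k : A k `&` G i `<=` (AB i).1 k.
  move=> x [[j _ [ABx Gj]] Gi].
  by have -> : i = j by apply: tG => //; exists x.
have BG k : B k `&` G i `<=` (AB i).2 k.
  move=> x [[j _ [ABx Gj]] Gi].
  by have -> : i = j by apply: tG => //; exists x.
split.
  move=> k; case: leqP => km; last first.
    by split=> //; [exact: open0|exact: open0|rewrite set0I].
  have [oV tV _] := HV k km; split.
  - by apply: openI => //; apply: bigcup_open => Z [/oV].
  - by apply: openI => //; apply: bigcup_open => Z [/oV].
  - by move=> x [[Z [_ ZA] Zx] Gx]; apply: AG; split=> //; exact: ZA.
  - by move=> x [[Z [_ _ ZB] Zx] Gx]; apply: BG; split=> //; exact: ZB.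
  - rewrite -subset0 => x [[[Z [VZ ZA] Zx] _] [[T [VT TA _] Tx] _]].
    by apply: TA; have <- : Z = T by apply: tV => //; exists x.
move=> x [Gx nCx]; have : setT x by [].
rewrite -cV => -[k /= km [Z VZ Zx]].
exists k => /=; first exact: leq_ltn_trans km mi.
rewrite km; have [ZA|ZA] := pselect (Z `<=` A k).
  by left; split=> //; exists Z.
have [_ _ /(_ Z VZ)[T [->|[->|->]] // ZT]] := HV k km.
  by case: nCx; exact: ZT.
by right; split=> //; exists Z.
Qed.

(** If the least bound [m i] of some piece exceeded [N], the preceding result for [(m i).-1] would
    improve it. *)
Lemma finite_partition_dim_discrete (I : choiceType) (G : I -> set X) C :
  discrete_pieces G C -> (forall i, finite_partition_dim (G i `\` C)) ->
  finite_partition_dim (~` C).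
Proof.
move=> dG SG.
have /choice[m Hm] : forall i, exists m, partition_dim_lt m (G i `\` C) /\
    forall k, partition_dim_lt k (G i `\` C) -> (m <= k)%N.
  move=> i; have [n Sn] := SG i.
  have ex : exists k, `[< partition_dim_lt k (G i `\` C) >].
    by exists n; exact/asboolP.
  exists (ex_minn ex); case: ex_minnP => k /asboolP Sk mink; split=> // l Sl.
  by apply: mink; exact/asboolP.
have [N HN] := finite_C_discrete_pieces (fun i => (m i).-1) dG.
exists N; apply: (partition_dim_lt_discrete dG) => i.
have [Sm minm] := Hm i; have [mN|Nm] := leqP (m i) N.
  exact: partition_dim_ltW mN Sm.
have mi := ltn_predK Nm.
have : (m i <= (m i).-1)%N by apply: minm; apply: HN; rewrite -ltnS mi.
by rewrite -{1}mi ltnn.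
Qed.

Lemma finite_partition_dim_sub D E : closed E -> E `<=` D ->
  finite_partition_dim D -> finite_partition_dim E.
Proof. by move=> cE ED [n SD]; exists n; exact: partition_dim_lt_sub SD. Qed.

End partition_dimension.

(** Reading [b] as 0 or 1, the complement of [C b] consists of the bands
    [b + 2 j <= phi <= b + 2 j + 1], and the two parities exhaust [phi >= 0]. The [G b j] are
    disjoint open enlargements of the bands by 1/4. An unbounded [phi] thus becomes bounded on each
    piece of two discrete families. *)
Lemma ring_decomposition (R : realType) (X : topologicalType) (phi : X -> R) :
  continuous phi -> (forall x, 0 <= phi x) ->
  exists (C : bool -> set X) (G : bool -> nat -> set X),
    [/\ forall b, discrete_pieces (G b) (C b), forall x, exists b, ~ C b x &
     forall b j x, (G b j `\` C b) x -> phi x < (j.*2 + 3)%:R].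
Proof.
move=> cphi phi0.
have oI (c d : R) : open [set x | c < phi x < d].
  rewrite (_ : [set x | _] = phi @^-1` [set x | c < x] `&` phi @^-1` [set x | x < d]).
    by apply: openI; apply: open_comp => // *; exact: cphi.
  by apply/seteqP; split=> x /=; [move/andP|move=> [? ?]; apply/andP].
have oL (c : R) : open [set x | phi x < c].
  by apply: (@open_comp _ _ phi [set x | x < c]) => // *; exact: cphi.
have dbl (j : nat) : j.*2%:R = 2 * j%:R :> R by rewrite -mul2n natrM.
pose sh (b : bool) : R := if b then 1 else 0.
exists (fun b : bool => [set x | phi x < sh b] `|` \bigcup_j
  [set x | sh b + 2 * j%:R + 1 < phi x < sh b + 2 * j%:R + 2]).
exists (fun (b : bool) j => [set x | sh b + 2 * j%:R - 1 / 4 < phi x < sh b + 2 * j%:R + 5 / 4]).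
split.
- move=> b; split.
  + by move=> j; exact: oI.
  + move=> i j _ _ [x [/= /andP[i1 i2] /andP[j1 j2]]].
    apply/eqP; case: ltngtP => // ij; exfalso.
      have : i.+1%:R <= j%:R :> R by rewrite ler_nat.
      by rewrite -natr1 => ?; lra.
    have : j.+1%:R <= i%:R :> R by rewrite ler_nat.
    by rewrite -natr1 => ?; lra.
  + by apply: openU; [exact: oL|apply: bigcup_open => j _; exact: oI].
  + move=> x; have [|bx] := ltP (phi x) (sh b); first by left; left.
    pose t := (phi x - sh b) / 2; have t0 : 0 <= t by rewrite /t; lra.
    have [n /andP[nt tn]] : exists n : nat, n%:R <= t < n.+1%:R.
      by exists (Num.truncn t); exact: truncn_itv.
    rewrite -natr1 /t in tn; rewrite /t in nt.
    have [h|h] := ltP (phi x) (sh b + 2 * n%:R + 5 / 4).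
      by right; exists n => /=; apply/andP; split=> //; lra.
    by left; right; exists n => //=; apply/andP; split; lra.
- move=> x; have [n /andP[nt tn]] : exists n : nat, n%:R <= phi x < n.+1%:R.
    by exists (Num.truncn (phi x)); exact: truncn_itv.
  rewrite -natr1 in tn.
  have nE : n%:R = sh (odd n) + 2 * (n./2)%:R :> R.
    have -> : sh (odd n) = (odd n)%:R by rewrite /sh; case: (odd n).
    by rewrite -dbl -natrD odd_double_half.
  exists (odd n) => -[/= h|[j _ /= /andP[h1 h2]]].
    have : (0 : R) <= (n./2)%:R by [].
    by move=> ?; lra.
  have : (n./2)%:R < j%:R + 1 :> R by lra.
  rewrite natr1 ltr_nat ltnS -(ler_nat R) => ?; lra.
- move=> b j x [/= /andP[_ +] _]; rewrite natrD dbl => h.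
  have : sh b <= 1 by rewrite /sh; case: (b); rewrite ?lexx ?ler01.
  by move=> ?; lra.
Qed.

(** * Locally finite dimensional sets, and points without finite dimensional neighbourhoods *)

Section paracompact_finite_C.
Variables (R : realType) (X : topologicalType).
Hypotheses (pcX : paracompact X) (hdX : hausdorff_space X).

Section finite_C.
Hypothesis finC : finite_C_space X.

(** Discrete families are used at two scales. Where [phi] is bounded, finitely many cardinalities of
    [s] occur, and the [V s] of one cardinality form disjoint pieces of finite dimension; the rings
    then dispose of the bound on [phi]. *)
Lemma locally_finite_partition_dim (F : set X) : closed F ->
  (forall x, F x -> exists O D,
     [/\ open O, O x, closed D, O `<=` D & finite_partition_dim D]) ->
  finite_partition_dim F.
Proof.
move=> cF locF.
have /choice[W HW] : forall x, exists O, [/\ open O, O x &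
    (exists D, [/\ closed D, O `<=` D & finite_partition_dim D]) \/ O = ~` F].
  move=> x; have [/locF[P [D [? ? ? ? ?]]]|nF] := pselect (F x).
    by exists P; split=> //; left; exists D.
  by exists (~` F); split=> //; [rewrite openC|right].
have [||phi [V [cphi oV dV VW cV]]] := @barycentric_refinement R X pcX hdX X W.
- by move=> x; have [] := HW x.
- by move=> x; exists x; have [] := HW x.
have phi0 x : 0 <= phi x.
  by have [s [_ _]] := cV x; apply: le_trans.
have [C [G [dG cC Gphi]]] := ring_decomposition cphi phi0.
have small_ring (D : set X) M : closed D -> D `<=` F ->
    (forall x, D x -> phi x < M%:R) -> finite_partition_dim D.
  move=> cD DF Dphi.
  (* Stratum [k] collects the [V s] with [k] elements in [s]; index 0, used by no non-empty [s], is
     given to the complement of [D]. *)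
  pose T k := if (0 < k < M)%N
    then \bigcup_(s in [set s : {fset X} | #|` s| = k]) V s
    else if k == 0%N then ~` D else set0.
  have oT k : open (T k).
    rewrite /T; case: ifP => _; first by apply: bigcup_open => s _.
    by case: ifP => _; [rewrite openC|exact: open0].
  have covT x : exists k, T k x.
    have [Dx|nDx] := pselect (D x); last by exists 0%N; rewrite /T eqxx.
    have [s [Vs s0 sphi]] := cV x; exists #|` s|; rewrite /T s0 /=.
    have -> : (#|` s| < M)%N.
      by rewrite -(ltr_nat R); apply: le_lt_trans sphi _; exact: Dphi.
    by exists s.
  have [H [oH HT cH _]] : exists H : nat -> set X, [/\ forall i, open (H i),
      forall i, closure (H i) `<=` T i, forall x, exists i, H i x &
      locally_finite_indexed H] := paracompact_shrinking pcX hdX oT covT.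
  have DE : D `<=` \bigcup_(k in [set k | (k < M)%N])
      (if (0 < k)%N then closure (H k) `&` D else set0).
    move=> x Dx; have [k Hx] := cH x.
    have := HT k x (subset_closure Hx); rewrite /T.
    case: ifP => [/andP[k0 kM] _|_]; last by case: ifP.
    by exists k => //; rewrite k0; split=> //; exact: subset_closure.
  apply: (finite_partition_dim_sub cD DE).
  apply: finite_partition_dim_bigcup => k kM.
  case: ifPn => [k0|_]; last exact: finite_partition_dim0.
  have cE : closed (closure (H k) `&` D) by apply: closedI => //; exact: closed_closure.
  rewrite -[_ `&` D]setCK.
  have dV' : discrete_pieces
      (fun s : {fset X} => if #|` s| == k then V s else set0)
      (~` (closure (H k) `&` D)).
    split.
    - by move=> s; case: ifP => _ //; exact: open0.
    - move=> s t _ _ [x []].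
      case: ifPn => // /eqP sk Vs; case: ifPn => // /eqP tk Vt.
      by apply: dV; [rewrite sk tk|exists x].
    - by rewrite openC.
    - move=> x; have [[Hx Dx]|] := pselect ((closure (H k) `&` D) x); last by left.
      have := HT k x Hx; rewrite /T k0 kM /= => -[s /= sk Vs].
      by right; exists s; rewrite sk eqxx.
  apply: (finite_partition_dim_discrete finC dV') => s.
  have := @closed_piece _ _ _ _ s dV'; case: ifPn => [/eqP sk cV'|_ _]; last first.
    by rewrite set0D; exact: finite_partition_dim0.
  have /fset0Pn[x xs] : s != fset0 by rewrite -cardfs_gt0 sk.
  have [_ _ [[E [clE WE SE]]|WF]] := HW x.
    apply: finite_partition_dim_sub SE => // y [Vs _].
    by apply: WE; exact: VW xs _ Vs.
  rewrite (_ : _ `\` _ = set0); first exact: finite_partition_dim0.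
  rewrite -subset0 => y [Vs /contrapT[_ /DF Fy]].
  by have := VW _ _ xs _ Vs; rewrite WF.
have FE : F `<=` (~` (C true `|` ~` F)) `|` (~` (C false `|` ~` F)).
  by move=> x Fx; have [[] nC] := cC x; [left|right]; case.
apply: (finite_partition_dim_sub cF FE).
have dGF b : discrete_pieces (G b) (C b `|` ~` F).
  have [oG tG oC cG] := dG b; split=> //; first by apply: openU => //; rewrite openC.
  by move=> x; have [?|?] := cG x; [left; left|right].
suff SF b : finite_partition_dim (~` (C b `|` ~` F)) by apply: finite_partition_dimU.
apply: (finite_partition_dim_discrete finC (dGF b)) => j.
apply: (small_ring _ (j.*2 + 3)%N).
- exact: closed_piece.
- by move=> x [_ nx]; apply: contrapT => nF; apply: nx; right.
- by move=> x [Gx nx]; apply: (Gphi b); split=> // Cx; apply: nx; left.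
Qed.

Definition essential_points : set X := [set x | ~ exists O D,
  [/\ open O, O x, closed D, O `<=` D & finite_partition_dim D]].

Lemma closed_essential_points : closed essential_points.
Proof.
rewrite -openC openE => x /contrapT[N [D [oN Nx cD ND SD]]].
apply: (filterS _ (open_nbhs_nbhs (conj oN Nx))) => y Ny; apply; by exists N, D.
Qed.

(** Otherwise there are essential points [x m] at which the values of [phi] are at least 3 apart.
    The closed bands of half-width 1/2 about these values are discrete pieces, and for some [N] the
    band number [N], a closed neighbourhood of [x N], has dimension below [N]. *)
Lemma bounded_essential_points (phi : X -> R) : continuous phi ->
  exists M : nat, forall x, essential_points x -> phi x < M%:R.
Proof.
move=> cphi; apply: contrapT => unb.
have /choice[g Hg] : forall t : R, exists x, essential_points x /\ t <= phi x.
  move=> t; apply: contrapT => nx; apply: unb.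
  exists (Num.truncn `|t|).+1 => x Kx.
  have [|tx] := ltP (phi x) t; last by case: nx; exists x.
  move=> /lt_le_trans; apply; apply: le_trans (ler_norm t) _.
  by apply: ltW; have /andP[] := truncn_itv (normr_ge0 t).
pose x := fix x m := if m is m'.+1 then g (phi (x m') + 3) else g 0.
have Kx m : essential_points (x m).
  by case: m => [|m] /=; [have [] := Hg 0|have [] := Hg (phi (x m) + 3)].
pose t m := phi (x m).
have tS m : t m + 3 <= t m.+1 by have [] := Hg (phi (x m) + 3).
have tle m n : (m <= n)%N -> t m <= t n.
  elim: n => [|n IH]; first by rewrite leqn0 => /eqP ->.
  rewrite leq_eqVlt => /orP[/eqP -> //|]; rewrite ltnS => /IH.
  by have := tS n; lra.
have t3 m : 3 * m%:R <= t m.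
  elim: m => [|m IH]; first by rewrite mulr0; have [] := Hg 0.
  by rewrite -natr1; have := tS m; lra.
have oI (c d : R) : open [set x | c < phi x < d].
  rewrite (_ : [set x | _] = phi @^-1` [set x | c < x] `&` phi @^-1` [set x | x < d]).
    by apply: openI; apply: open_comp => // *; exact: cphi.
  by apply/seteqP; split=> y /=; [move/andP|move=> [? ?]; apply/andP].
have oL (c : R) : open [set x | phi x < c].
  by apply: (@open_comp _ _ phi [set x | x < c]) => // *; exact: cphi.
pose C := [set x | phi x < t 0%N - 1 / 2] `|`
  \bigcup_m [set x | t m + 1 / 2 < phi x < t m.+1 - 1 / 2].
pose G m := [set x | t m - 1 < phi x < t m + 1].
have dG : discrete_pieces G C.
  split.
  - by move=> m; exact: oI.
  - move=> i j _ _ [y [/= /andP[i1 i2] /andP[j1 j2]]].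
    apply/eqP; case: ltngtP => // /tle ij; exfalso.
      by have := tS i; lra.
    by have := tS j; lra.
  - by apply: openU; [exact: oL|apply: bigcup_open => j _; exact: oI].
  - move=> y.
    have ex : exists m, phi y < t m - 1 / 2.
      exists (Num.truncn `|phi y|).+1.
      have := t3 (Num.truncn `|phi y|).+1; have := ler_norm (phi y).
      have /andP[_] := truncn_itv (normr_ge0 (phi y)).
      have : (0 : R) <= (Num.truncn `|phi y|)%:R by [].
      set n := Num.truncn _; rewrite -(natr1 n).
      move: (t _) (n%:R) (`|phi y|) => a c d h0 h1 h2 h3; lra.
    case: (ex_minnP ex) => -[|m] ym minm; first by left; left.
    have my : t m - 1 / 2 <= phi y.
      by rewrite leNgt; apply/negP => /minm; rewrite ltnn.
    have [h|h] := ltP (phi y) (t m + 1).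
      by right; exists m => /=; apply/andP; split=> //; lra.
    by left; right; exists m => //=; apply/andP; split=> //; lra.
have [N /(_ N (leqnn N)) SN] := finite_C_discrete_pieces finC id dG.
apply: (Kx N); exists [set y | t N - 1 / 2 < phi y < t N + 1 / 2], (G N `\` C).
split.
- exact: oI.
- by rewrite /= -/(t N); apply/andP; split; lra.
- exact: closed_piece.
- move=> y /= /andP[y1 y2]; split; first by rewrite /G /=; apply/andP; split; lra.
  case=> [/=|[m _ /= /andP[h1 h2]]]; first by have := tle 0%N N isT; lra.
  have [/tle mN|/tle mN] := ltnP m N; lra.
- by exists N.
Qed.

End finite_C.
End paracompact_finite_C.

(** * Arbitrary open covers of finite C-spaces *)

(** The contribution of one family in the C-property, recorded by its union [O] alone. This suffices
    because the property passes to open subsets and to disjoint unions. *)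
Definition disjointly_refines (X : topologicalType) (U : set (set X))
    (O : set X) :=
  exists V, [/\ open_family V, trivIset V id, refines V U &
    \bigcup_(A in V) A = O].

Section disjointly_refines.
Variable X : topologicalType.
Implicit Types (U : set (set X)) (O : set X).

Lemma disjointly_refines_open U O : disjointly_refines U O -> open O.
Proof. by move=> [V [oV _ _ <-]]; exact: bigcup_open. Qed.

Lemma disjointly_refines_sub U O P : open P -> P `<=` O ->
  disjointly_refines U O -> disjointly_refines U P.
Proof.
move=> oP PO [V [oV tV refV VO]].
exists [set A | exists2 B, V B & A = B `&` P]; split.
- by move=> _ [B /oV oB ->]; exact: openI.
- move=> _ _ [B VB ->] [B' VB' ->] [x [[Bx _] [B'x _]]].
  by rewrite (tV B B' VB VB') //; exists x.
- move=> _ [B VB ->]; have [D UD BD] := refV B VB; exists D => //.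
  by move=> x [/BD].
- apply/seteqP; split=> [x [_ [B VB ->] [_ Px]] //|x Px].
  have := PO x Px; rewrite -VO => -[B VB Bx].
  by exists (B `&` P) => //; exists B.
Qed.

Lemma disjointly_refines_bigcup (I : choiceType) (D : set I) (G : I -> set X) U :
  trivIset D G -> (forall i, D i -> disjointly_refines U (G i)) ->
  disjointly_refines U (\bigcup_(i in D) G i).
Proof.
move=> tG HG.
have /choice[V HV] : forall i, exists V, D i -> [/\ open_family V,
    trivIset V id, refines V U & \bigcup_(A in V) A = G i].
  move=> i; have [/HG[V HV]|nD] := pselect (D i); first by exists V.
  by exists set0.
have VG i A : D i -> V i A -> A `<=` G i.
  by move=> Di VA x Ax; have [_ _ _ <-] := HV i Di; exists A.
exists (\bigcup_(i in D) V i); split.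
- by move=> A [i Di VA]; have [oV _ _ _] := HV i Di; exact: oV.
- move=> A B [i Di VA] [j Dj VB] [x [Ax Bx]].
  have ij : i = j.
    by apply: tG => //; exists x; split; [exact: VG VA _ _|exact: VG VB _ _].
  rewrite -{j}ij in VB Dj; have [_ tV _ _] := HV i Di.
  by apply: tV => //; exists x.
- by move=> A [i Di VA]; have [_ _ rV _] := HV i Di; exact: rV.
- apply/seteqP; split=> [x [A [i Di VA] Ax]|x [i Di Gx]].
    by exists i => //; exact: VG VA _ _.
  have [_ _ _ GE] := HV i Di; move: Gx; rewrite -GE => -[A VA Ax].
  by exists A => //; exists i.
Qed.

Lemma disjointly_refines1 U O A : open O -> U A -> O `<=` A ->
  disjointly_refines U O.
Proof.
move=> oO UA OA; exists [set O]; split.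
- by move=> _ ->.
- by move=> _ _ -> ->.
- by move=> _ ->; exists A.
- by rewrite bigcup_set1.
Qed.

Lemma disjointly_refines0 U : disjointly_refines U set0.
Proof.
exists set0; split; [by []|by move=> ? ? []|by []|by rewrite bigcup_set0].
Qed.

Lemma disjointly_refines_coarser U U' O :
  (forall A, U A -> exists2 B, U' B & A `<=` B) ->
  disjointly_refines U O -> disjointly_refines U' O.
Proof.
move=> UU' [V [oV tV rV VO]]; exists V; split=> // A /rV[B /UU'[D UD BD] AB].
by exists D => //; exact: subset_trans BD.
Qed.

End disjointly_refines.

Section finite_C_arbitrary_covers.
Variables (R : realType) (X : topologicalType).
Hypotheses (pcX : paracompact X) (hdX : hausdorff_space X).

(* With [D] covered by disjoint [P i], [Q i], where [Q i] avoids a shrunken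
   [W t] for the [i]-th element [t] of [S], replace [W t] by that shrunken set
   together with [P i] for the first [n] elements, and cut all other [W t] down
   to the union of the [Q i]. *)
Lemma partition_dim_shrink1 (T : finType) n (D : set X) (W : T -> set X)
    (S : {set T}) : closed D -> partition_dim_lt n D ->
  (forall t, open (W t)) -> D `<=` \bigcup_t W t -> (n < #|S|)%N ->
  exists W' : T -> set X, [/\ forall t, open (W' t), forall t, W' t `<=` W t,
    D `<=` \bigcup_t W' t & \bigcap_(t in [set` S]) W' t = set0].
Proof.
move=> cD SD oW DW nS.
have [||H [oH HW cH _]] := @paracompact_shrinking X pcX hdX (option T)
    (fun o => if o is Some t then W t else ~` D).
- by case=> [t|] //; rewrite openC.
- move=> x; have [/DW[t _ Wx]|nD] := pselect (D x); first by exists (Some t).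
  by exists None.
have [t0 t0S] : exists t0, t0 \in S.
  by apply/set0Pn; rewrite -card_gt0; apply: leq_ltn_trans nS.
pose s := nth t0 (enum S).
have [i|P [Q [HPQ DPQ]]] := SD (fun i => W (s i))
    (fun i => ~` closure (H (Some (s i)))).
  split=> //; first by rewrite openC; exact: closed_closure.
  move=> x _; have [/HW ?|?] := pselect (closure (H (Some (s i))) x); [by left|by right].
pose W' t := if (index t (enum S) < n)%N then P (index t (enum S)) `|` H (Some t)
  else W t `&` \bigcup_(i in [set i | (i < n)%N]) Q i.
have sS i : (i < #|S|)%N -> index (s i) (enum S) = i.
  by move=> iS; rewrite index_uniq ?enum_uniq // -cardE.
have tS t : (index t (enum S) < n)%N -> s (index t (enum S)) = t.
  move=> tn; rewrite /s nth_index // -index_mem -cardE.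
  exact: ltn_trans tn nS.
have W'W t : W' t `<=` W t.
  rewrite /W'; case: ifPn => [tn|_] x; last by case.
  case=> [|Hx]; last by have := HW (Some t) x; apply; exact: subset_closure.
  by have [_ _ + _ _] := HPQ (index t (enum S)); rewrite tS //; apply.
exists W'; split=> //.
- move=> t; rewrite /W'; case: ifPn => _; [apply: openU => //|apply: openI => //].
    by have [] := HPQ (index t (enum S)).
  by apply: bigcup_open => i _; have [] := HPQ i.
- move=> x Dx; have [[t|] Hx] := cH x; last first.
    by have := HW None x (subset_closure Hx).
  have Wx := HW (Some t) x (subset_closure Hx).
  have [tn|tn] := boolP (index t (enum S) < n)%N.
    by exists t => //; rewrite /W' tn; right.
  have [i /= im [Px|Qx]] := DPQ x Dx.
    have iS := ltn_trans im nS.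
    by exists (s i) => //; rewrite /W' sS // im; left.
  by exists t => //; rewrite /W' (negbTE tn); split=> //; exists i.
- rewrite -subset0 => x Wx.
  have snS i : (i < #|S|)%N -> s i \in S.
    by move=> iS; rewrite -mem_enum mem_nth // -cardE.
  (* The element of [S] at position [n] is the first one cut down, so [x] lies in some [Q i] with
     [i < n]; position [i] offers only [P i] and the shrunken set, both disjoint from [Q i]. *)
  have := Wx (s n) (snS n nS); rewrite /W' sS // ltnn => -[_ [i /= im Qx]].
  have iS := ltn_trans im nS.
  have [_ _ _ QH PQ] := HPQ i.
  have := Wx (s i) (snS i iS); rewrite /W' sS // im => -[Px|/subset_closure Hx].
    by have : (P i `&` Q i) x by []; rewrite PQ.
  exact: (QH x Qx Hx).
Qed.

(** The subsets [S] are treated one after another; further shrinking keeps the intersections that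
    are already empty. The result is the classical shrinking of a finite cover to order at most
    [n]. *)
Lemma partition_dim_shrink (T : finType) n (D : set X) (W : T -> set X) :
  closed D -> partition_dim_lt n D ->
  (forall t, open (W t)) -> D `<=` \bigcup_t W t ->
  exists W' : T -> set X, [/\ forall t, open (W' t), forall t, W' t `<=` W t,
    D `<=` \bigcup_t W' t &
    forall S : {set T}, (n < #|S|)%N -> \bigcap_(t in [set` S]) W' t = set0].
Proof.
move=> cD SD oW DW.
suff [W' [oW' W'W DW' HW']] : exists W' : T -> set X, [/\ forall t, open (W' t),
    forall t, W' t `<=` W t, D `<=` \bigcup_t W' t &
    forall S : {set T}, S \in index_enum {set T} -> (n < #|S|)%N ->
      \bigcap_(t in [set` S]) W' t = set0].
  by exists W'; split=> // S; apply: HW'; exact: mem_index_enum.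
elim: (index_enum _) => [|S r [W' [oW' W'W DW' HW']]].
  by exists W; split=> // t; exact: subset_refl.
have [nS|nS] := ltnP n #|S|; last first.
  exists W'; split=> // S'; rewrite inE => /orP[/eqP -> |/HW' //].
  by rewrite ltnNge nS.
have [W2 [oW2 W2W DW2 HW2]] := partition_dim_shrink1 cD SD oW' DW' nS.
exists W2; split=> //.
  by move=> t; apply: subset_trans (W2W t) (W'W t).
move=> S'; rewrite inE => /orP[/eqP -> //|S'r nS'].
rewrite -subset0 => x Wx; rewrite -(HW' S' S'r nS') => t tS.
by apply: W2W; exact: Wx.
Qed.

(** After shrinking, a point of [D] lies in at most [n] members, so in a barycentric refinement only
    sets [V s] with at most [n] elements in [s] meet [D]. Each cardinality gives one disjoint
    family, so the number of families is independent of the size of [T]. *)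
Lemma finite_cover_disjointly_refines (T : finType) n (D : set X)
    (W : T -> set X) (U : set (set X)) :
  closed D -> partition_dim_lt n D ->
  (forall t, disjointly_refines U (W t)) -> D `<=` \bigcup_t W t ->
  exists Q : nat -> set X, (forall i, disjointly_refines U (Q i)) /\
    D `<=` \bigcup_(i in [set i | (i < n)%N]) Q i.
Proof.
move=> cD SD dW DW.
have oW t : open (W t) by exact: disjointly_refines_open.
have [W' [oW' W'W DW' HW']] := partition_dim_shrink cD SD oW DW.
have [||phi [V [_ oV dV VW cV]]] := @barycentric_refinement R X pcX hdX (option T)
    (fun o => if o is Some t then W' t else ~` D).
- by case=> [t|] //; rewrite openC.
- move=> x; have [/DW'[t _ Wx]|nD] := pselect (D x); first by exists (Some t).
  by exists None.
exists (fun i => \bigcup_(s in [set s : {fset option T} |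
  #|` s| = i.+1 /\ None \notin s]) V s); split.
  move=> i; apply: disjointly_refines_bigcup.
    by move=> s t /= [si _] [ti _]; apply: dV; rewrite si ti.
  move=> s /= [si Ns].
  have /fset0Pn[[t|] ts] : s != fset0 by rewrite -cardfs_gt0 si.
    apply: disjointly_refines_sub (dW t) => //.
    by apply: subset_trans (W'W t); exact: VW ts.
  by rewrite ts in Ns.
move=> x Dx; have [s [Vs s0 _]] := cV x.
have Ns : None \notin s by apply/negP => /VW /(_ x Vs).
exists #|` s|.-1 => /=; last by exists s => //=; rewrite prednK.
rewrite prednK // leqNgt; apply/negP => ns.
pose S := [set t | Some t \in s]%SET.
have SE : (#|` s| <= #|S|)%N.
  have -> : s = [fset Some t | t in S]%fset.
    apply/fsetP => -[t|].
      apply/idP/imfsetP => [ts|[t' /= t'S [->]]].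
        by exists t => //=; rewrite inE.
      by rewrite inE in t'S.
    apply/idP/imfsetP => [N|[]//]; by rewrite N in Ns.
  by apply: leq_trans (leq_imfset_card _ _ _) _; rewrite /= cardE.
have /seteqP[/(_ x) + _] := HW' S (leq_trans ns SE); apply.
by move=> t /=; rewrite inE => /VW; apply.
Qed.

(** On a ring, the strata by cardinality form a finite cover by sets that disjointly refine [U],
    which is reduced to [n] sets whatever the bound of [phi] on that ring. Rings of one parity are
    therefore glued index by index, and the two parities account for [n + n]. *)
Lemma partition_dim_disjointly_refines n (F : set X) (U : set (set X)) :
  open_cover U -> closed F -> partition_dim_lt n F ->
  exists Q : nat -> set X, (forall i, disjointly_refines U (Q i)) /\
    F `<=` \bigcup_(i in [set i | (i < n + n)%N]) Q i.
Proof.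
move=> [oU cU] cF SF.
have [||phi [V [cphi oV dV VW cV]]] := @barycentric_refinement R X pcX hdX
    (set X) (fun A => if `[< U A >] then A else set0).
- by move=> A; case: asboolP => [/oU //|_]; exact: open0.
- move=> x; have : setT x by []. rewrite -cU => -[A UA Ax].
  by exists A; rewrite asboolT.
have phi0 x : 0 <= phi x by have [s [_ _]] := cV x; apply: le_trans.
have [C [G [dG cC Gphi]]] := ring_decomposition cphi phi0.
have ring_refines (D : set X) M : closed D -> D `<=` F ->
    (forall x, D x -> phi x < M%:R) -> exists Q : nat -> set X,
      (forall i, disjointly_refines U (Q i)) /\
      D `<=` \bigcup_(i in [set i | (i < n)%N]) Q i.
  move=> cD DF Dphi.
  (* The empty [s] is excluded, since nothing confines [V fset0] to a member of [U]. *)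
  apply: (@finite_cover_disjointly_refines 'I_M n D (fun t => \bigcup_(s in
    [set s : {fset set X} | #|` s| = t /\ s != fset0]) V s)) => //.
  - exact: partition_dim_lt_sub SF.
  - move=> t; apply: disjointly_refines_bigcup.
      by move=> s s' /= [st _] [s't _]; apply: dV; rewrite st s't.
    move=> s [_ /fset0Pn[A As]].
    have := VW _ _ As; case: asboolP => [UA VA|_ V0].
      exact: disjointly_refines1 UA VA.
    by have -> : V s = set0; [rewrite -subset0|exact: disjointly_refines0].
  - move=> x Dx; have [s [Vs s0 sphi]] := cV x.
    have sM : (#|` s| < M)%N.
      by rewrite -(ltr_nat R); apply: le_lt_trans sphi _; exact: Dphi.
    by exists (Ordinal sM) => //; exists s => //=; rewrite -cardfs_gt0.
have dGF b : discrete_pieces (G b) (C b `|` ~` F).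
  have [oG tG oC cG] := dG b; split=> //; first by apply: openU => //; rewrite openC.
  by move=> x; have [?|?] := cG x; [left; left|right].
have /choice[Q HQ] : forall bj : bool * nat, exists Q : nat -> set X,
      (forall i, disjointly_refines U (Q i)) /\
      G bj.1 bj.2 `\` (C bj.1 `|` ~` F) `<=` \bigcup_(i in [set i | (i < n)%N]) Q i.
  move=> [b j]; apply: (ring_refines _ (j.*2 + 3)%N).
  - exact: closed_piece.
  - by move=> x [_ nx]; apply: contrapT => nF; apply: nx; right.
  - by move=> x [Gx nx]; apply: (Gphi b); split=> // Cx; apply: nx; left.
pose Qb b i := \bigcup_j (Q (b, j) i `&` G b j).
have dQb b i : disjointly_refines U (Qb b i).
  have [oG tG _ _] := dG b.
  apply: disjointly_refines_bigcup.
    by move=> j k _ _ [x [[_ Gj] [_ Gk]]]; apply: tG => //; exists x.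
  move=> j _; have [/(_ i) dQ _] := HQ (b, j).
  apply: disjointly_refines_sub (dQ); last by move=> x [].
  by apply: openI => //; exact: disjointly_refines_open dQ.
exists (fun i => if (i < n)%N then Qb true i else Qb false (i - n)%N); split.
  by move=> i; case: ifP.
move=> x Fx; have [b nC] := cC x.
have nCF : ~ (C b `|` ~` F) x by case.
have [_ _ _ /(_ x)[|[j Gx]]] := dG b; first by [].
have [_ /(_ x (conj Gx nCF))[i /= im Qx]] := HQ (b, j).
case: b nC nCF Gx Qx => nC nCF Gx Qx.
  exists i => /=; first exact: leq_trans im (leq_addr _ _).
  by rewrite im; exists j.
exists (n + i)%N => /=; first by rewrite ltn_add2l.
by rewrite ltnNge leq_addr /= addKn; exists j.
Qed.

(** The order of choices matters: [n] is fixed by the covers around [K], the dimension bound [m] of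
    the rest is known only afterwards, and the rest is exhausted by the [m + m] covers numbered
    after [n]. *)
Lemma finite_C_disjointly_refines (U : nat -> set (set X)) :
  finite_C_space X -> (forall k, open_cover (U k)) ->
  exists n (Q : nat -> set X), (forall k, disjointly_refines (U k) (Q k)) /\
    \bigcup_(k in [set k | (k <= n)%N]) Q k = [set: X].
Proof.
move=> finC oU; pose K := @essential_points X.
(* A bound of [phi] on [K] leaves finitely many cardinalities, hence finitely many strata, even if
   [U k] is infinite. *)
have /choice[E HE] : forall k, exists E : set (set X), [/\ finite_set E,
    (forall O, E O -> disjointly_refines (U k) O) & K `<=` \bigcup_(O in E) O].
  move=> k; have [oUk cUk] := oU k.
  have [||phi [V [cphi oV dV VW cV]]] := @barycentric_refinement R X pcX hdX
      (set X) (fun A => if `[< U k A >] then A else set0).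
  - by move=> A; case: asboolP => [/oUk //|_]; exact: open0.
  - move=> x; have : setT x by []. rewrite -cUk => -[A UA Ax].
    by exists A; rewrite asboolT.
  have [M KM] := bounded_essential_points finC cphi.
  exists ((fun t => \bigcup_(s in
    [set s : {fset set X} | #|` s| = t /\ s != fset0]) V s) @` `I_M); split.
  - by apply: finite_image; exact: finite_II.
  - move=> _ [t _ <-]; apply: disjointly_refines_bigcup.
      by move=> s s' /= [st _] [s't _]; apply: dV; rewrite st s't.
    move=> s [_ /fset0Pn[A As]].
    have := VW _ _ As; case: asboolP => [UA VA|_ V0].
      exact: disjointly_refines1 UA VA.
    by have -> : V s = set0; [rewrite -subset0|exact: disjointly_refines0].
  - move=> x /KM phix; have [s [Vs s0 sphi]] := cV x.
    exists (\bigcup_(s' in [set s' : {fset set X} | #|` s'| = #|` s| /\ s' != fset0]) V s').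
      by exists #|` s| => //=; rewrite -(ltr_nat R); exact: le_lt_trans sphi phix.
    by exists s => //=; rewrite -cardfs_gt0.
case: (finC) => _ /(_ (fun k => [set ~` K] `|` E k)) [k|n [V [HV cV]]].
  have [fE dE KE] := HE k; split; last by rewrite finite_setU; split.
  split.
    move=> O [->|/dE /disjointly_refines_open //].
    by rewrite openC; exact: closed_essential_points.
  apply/seteqP; split=> // x _; have [/KE[B EB Bx]|nK] := pselect (K x).
    by exists B => //; right.
  by exists (~` K) => //; left.
(* Sets of [V k] contained in no member of [E k] need not refine [U k] and are dropped; they lie in
   the complement of [K]. *)
pose Q1 k := if (k <= n)%N
  then \bigcup_(Z in [set Z | V k Z /\ exists2 O, E k O & Z `<=` O]) Z else set0.
have dQ1 k : disjointly_refines (U k) (Q1 k).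
  rewrite /Q1; case: ifPn => [kn|_]; last exact: disjointly_refines0.
  have [oV tV _] := HV k kn; have [_ dE _] := HE k.
  apply: disjointly_refines_bigcup.
    by move=> Z Z' [VZ _] [VZ' _]; exact: tV.
  by move=> Z [/oV oZ [B /dE dB ZB]]; exact: disjointly_refines_sub dB.
pose P := \bigcup_(k in [set k | (k <= n)%N]) Q1 k.
have oP : open P.
  by apply: bigcup_open => k _; exact: disjointly_refines_open (dQ1 k).
have KP : K `<=` P.
  move=> x Kx; have : setT x by []. rewrite -cV => -[k /= kn [Z VZ Zx]].
  exists k => //; rewrite /Q1 kn; exists Z => //; split=> //.
  have [_ _ /(_ Z VZ)[B [->|EB] ZB]] := HV k kn; last by exists B.
  by have := ZB x Zx.
have [||m Sm] := @locally_finite_partition_dim R X pcX hdX finC (~` P).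
- by rewrite closedC.
- by move=> x nP; apply: contrapT => Kx; apply: nP; exact: KP.
(* The dimension argument refines a single cover, while family [n.+1 + i] has to refine
   [U (n.+1 + i)]; hence this common refinement of [m + m] covers. *)
pose U' : set (set X) := [set A | open A /\ forall i, (i < m + m)%N ->
  exists2 B, U (n.+1 + i)%N B & A `<=` B].
have oU' : open_cover U'.
  split=> [A []//|]; apply/seteqP; split=> // x _.
  have /choice[f Hf] : forall i, exists B, U (n.+1 + i)%N B /\ B x.
    move=> i; have [_ cUi] := oU (n.+1 + i)%N.
    by have : setT x by []; rewrite -cUi => -[B UB Bx]; exists B.
  exists (\bigcap_(i in [set i | (i < m + m)%N]) f i); last first.
    by move=> i _; have [] := Hf i.
  split.
    rewrite bigcap_mkord; apply: big_ind; [exact: openT|exact: openI|].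
    by move=> i _; have [UB _] := Hf i; have [oUi _] := oU (n.+1 + i)%N; exact: oUi.
  by move=> i im; exists (f i); [have [] := Hf i|move=> y; apply].
have cP : closed (~` P) by rewrite closedC.
have [Q2 [dQ2 cQ2]] := partition_dim_disjointly_refines oU' cP Sm.
exists (n + (m + m))%N, (fun k => if (k <= n)%N then Q1 k else
  if (k - n.+1 < m + m)%N then Q2 (k - n.+1)%N else set0); split.
  move=> k; case: (leqP k n) => // nk; case: ifPn => [km|_]; last exact: disjointly_refines0.
  apply: disjointly_refines_coarser (dQ2 _) => A [_ /(_ _ km)].
  by rewrite subnKC.
apply/seteqP; split=> // x _.
have [[k /= kn Qx]|/cQ2[i /= im Qx]] := pselect (P x).
  by exists k => /=; [exact: leq_trans kn (leq_addr _ _)|rewrite kn].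
exists (n.+1 + i)%N => /=; first by rewrite addSn -addnS leq_add2l.
by rewrite addSn ltnNge leq_addr /= -addSn addKn im.
Qed.

End finite_C_arbitrary_covers.

(** * Simplices in the free normed space *)

Section free_space_simplex.
Variables (R : realType) (V : choiceType).
Local Notation E := (free_space R V).

Lemma free_coord_sum (I : Type) (r : seq I) (P : pred I) (F : I -> E) v :
  (\sum_(i <- r | P i) F i) v = \sum_(i <- r | P i) F i v.
Proof. by elim/big_rec2: _ => [//|i x p _ <-]. Qed.

Lemma free_coord_norm (p : E) v : `|p v| <= `|p|.
Proof.
have /Defs.finsuppP fp := free_valP p.
have fp' : finite_set (v |` [set w | p w != 0]).
  by rewrite finite_setU; split.
rewrite [leRHS](free_normE fp'); last by move=> w; right.
rewrite (fsbigD1 v) //=; last by left.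
rewrite lerDl fsbig_finite; last exact: finite_setD.
by apply: sumr_ge0 => w _; exact: normr_ge0.
Qed.

Lemma continuous_free_coord v : continuous (fun p : E => p v).
Proof.
move=> p; rewrite /continuous_at; have FF : Filter (nbhs p) by exact: nbhs_filter.
apply/cvgrPdist_lt => e e0; apply: filterS (nbhsx_ballx p e e0) => q.
rewrite -ball_normE; exact: le_lt_trans (free_coord_norm (p - q) v).
Qed.

Lemma cvg_free_sum (T : Type) (F : set_system T) (I : Type) (r : seq I)
    (q : I -> T -> R) (a : I -> R) (w : I -> E) : Filter F ->
  (forall i, q i @ F --> a i) ->
  (fun z => \sum_(i <- r) q i z *: w i) @ F --> \sum_(i <- r) a i *: w i.
Proof.
move=> FF qa; apply: cvg_big => [|i _]; first exact: add_continuous.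
by apply: cvgZ; [exact: qa|exact: cvg_cst].
Qed.

(** Barycentric coordinates stand in for the convex hull of the vertices; [closed_simplexE] shows
    that the two agree. *)
Definition std_simplex (s : {fset V}) : set E := [set p |
  [/\ forall v, 0 <= p v, forall v, p v != 0 -> v \in s &
      \sum_(v <- s) p v = 1]].

Lemma std_simplex_sum (s t : {fset V}) (p : E) :
  (forall v, p v != 0 -> v \in s) -> (forall v, p v != 0 -> v \in t) ->
  \sum_(v <- s) p v = \sum_(v <- t) p v.
Proof.
move=> ps pt; rewrite (_ : \sum_(v <- s) _ = \sum_(v \in [set` s]) p v); last first.
  by rewrite fsbig_finite //= set_fsetK.
rewrite (_ : \sum_(v <- t) _ = \sum_(v \in [set` t]) p v); last first.
  by rewrite fsbig_finite //= set_fsetK.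
rewrite (@fsbig_widen _ _ _ _ [set` s] setT) //; last first.
  by move=> v [_ /=] vs; apply/eqP; apply: contrapT => /negP /ps.
rewrite (@fsbig_widen _ _ _ _ [set` t] setT) //.
by move=> v [_ /=] vs; apply/eqP; apply: contrapT => /negP /pt.
Qed.

Lemma std_simplexW (s t : {fset V}) (p : E) : std_simplex s p ->
  (forall v, p v != 0 -> v \in t) -> std_simplex t p.
Proof. by move=> [p0 ps p1] pt; split=> //; rewrite -p1; exact: std_simplex_sum. Qed.

Lemma std_simplex_sub (s t : {fset V}) : {subset s <= t} ->
  std_simplex s `<=` std_simplex t.
Proof. by move=> st p sp; apply: (std_simplexW sp) => v; case: sp => _ /(_ v) ps _ /ps/st. Qed.

Lemma std_simplex_combination (I : Type) (r : seq I) (P : pred I) (t : I -> R) (f : I -> V)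
    (s : {fset V}) : (forall i, P i -> 0 <= t i) ->
  (forall i, P i -> t i != 0 -> f i \in s) -> \sum_(i <- r | P i) t i = 1 ->
  std_simplex s (\sum_(i <- r | P i) t i *: vertex R (f i)).
Proof.
move=> t0 fs t1.
have pE v : (\sum_(i <- r | P i) t i *: vertex R (f i)) v =
    \sum_(i <- r | P i) t i * (v == f i)%:R by rewrite free_coord_sum.
split=> [v|v|].
- by rewrite pE; apply: sumr_ge0 => i Pi; rewrite mulr_ge0 ?t0.
- rewrite pE => nz; apply: contraNT nz => vs; apply/eqP; apply: big1 => i Pi.
  have [->|ti] := eqVneq (t i) 0; first by rewrite mul0r.
  case: eqP => [vf|_]; last by rewrite mulr0.
  by move: (fs i Pi ti); rewrite -vf (negbTE vs).
- under eq_bigr do rewrite pE.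
  rewrite exchange_big /= -[RHS]t1; apply: eq_bigr => i Pi.
  rewrite -big_distrr /=.
  have [->|ti] := eqVneq (t i) 0; first by rewrite mul0r.
  rewrite (big_fsetD1 (f i)) ?fs //= eqxx big_seq big1 ?addr0 ?mulr1 // => v.
  by rewrite !inE => /andP[/negbTE ->].
Qed.

Lemma std_simplex_vertex (s : {fset V}) v : v \in s -> std_simplex s (vertex R v).
Proof.
move=> vs; have := @std_simplex_combination unit [:: tt] predT (fun=> 1) (fun=> v) s.
by rewrite !big_seq1 scale1r; apply.
Qed.

Lemma free_vertex_sum (s : {fset V}) (p : E) : (forall v, p v != 0 -> v \in s) ->
  p = \sum_(v <- s) p v *: vertex R v.
Proof.
move=> ps; apply: val_inj; apply/funext => v.
rewrite /= [RHS](free_coord_sum) /=.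
have -> : \sum_(w <- s) (p w *: vertex R w) v = \sum_(w <- s) p w * (v == w)%:R by [].
have [vs|vs] := boolP (v \in s).
  rewrite (big_fsetD1 v) //= eqxx mulr1 big_seq big1 ?addr0 // => w.
  by rewrite !inE eq_sym => /andP[/negbTE ->]; rewrite mulr0.
rewrite big_seq big1 => [|w ws]; first by apply/eqP; apply: contraNT vs => /ps.
by case: eqP => [vw|_]; rewrite ?mulr0 //; rewrite vw ws in vs.
Qed.

Lemma closed_simplexE (s : set V) : finite_set s ->
  closed_simplex (@vertex R V) s = std_simplex (fset_set s).
Proof.
move=> fs; apply/seteqP; split=> [p [m [t [a [t0 t1 sa ->]]]]|p sp].
  have /choice[f Hf] : forall i, exists v, s v /\ vertex R v = a i.
    by move=> i; have [v sv va] := sa i; exists v.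
  under eq_bigr do rewrite -(proj2 (Hf _)).
  apply: std_simplex_combination => // i _ _.
  by rewrite in_fset_set // inE; have [] := Hf i.
have [p0 ps p1] := sp.
exists (size (fset_set s)), (fun i => p (tnth (in_tuple (fset_set s)) i)),
  (fun i => vertex R (tnth (in_tuple (fset_set s)) i)); split.
- by move=> i; exact: p0.
- by rewrite -p1 (big_tnth _ _ (fset_set s)).
- move=> i; exists (tnth (in_tuple (fset_set s)) i) => //.
  have := mem_tnth i (in_tuple (fset_set s)).
  by rewrite memtE /= in_fset_set // inE.
- by rewrite {1}(free_vertex_sum ps) (big_tnth _ _ (fset_set s)).
Qed.

Lemma affine_hullP (s : set V) (p : E) : finite_set s ->
  affine_hull (closed_simplex (@vertex R V) s) p <->
  (forall v, p v != 0 -> v \in fset_set s) /\ \sum_(v <- fset_set s) p v = 1.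
Proof.
move=> fs; rewrite closed_simplexE //; split=> [[m [t [a [t1 sa ->]]]]|[ps p1]].
  split=> [v|].
    rewrite free_coord_sum => nz; apply: contraNT nz => vs.
    apply/eqP; apply: big1 => i _; have [_ /(_ v) av _] := sa i.
    have [a0|/av] := eqVneq (a i v) 0; last by rewrite (negbTE vs).
    by rewrite -[LHS]/(t i * a i v) a0 mulr0.
  under eq_bigr do rewrite free_coord_sum.
  rewrite exchange_big /= -[RHS]t1; apply: eq_bigr => i _.
  by rewrite -big_distrr /=; have [_ _ ->] := sa i; rewrite mulr1.
exists (size (fset_set s)), (fun i => p (tnth (in_tuple (fset_set s)) i)),
  (fun i => vertex R (tnth (in_tuple (fset_set s)) i)); split.
- by rewrite -p1 (big_tnth _ _ (fset_set s)).
- move=> i; have := mem_tnth i (in_tuple (fset_set s)); rewrite memtE /= => si.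
  exact: std_simplex_vertex.
- by rewrite {1}(free_vertex_sum ps) (big_tnth _ _ (fset_set s)).
Qed.

(** If the coordinate at [v] vanished, a small step away from the vertex [v] would stay in the
    affine hull and make that coordinate negative. *)
Lemma open_simplex_gt0 (s : set V) (p : E) v : finite_set s -> s v ->
  open_simplex (@vertex R V) s p -> 0 < p v.
Proof.
move=> fs sv [sp /nbhs_ballP[e /= e0 pe]].
move: (sp); rewrite closed_simplexE // => -[p0 ps p1].
rewrite lt_neqAle p0 andbT; apply/eqP => pv0.
pose d := e / (2 * (`|p - vertex R v| + 1)).
have N0 : 0 < `|p - vertex R v| + 1 by rewrite ltr_wpDl.
have d0 : 0 < d by rewrite /d divr_gt0 // mulr_gt0.
pose y : E := p + d *: (p - vertex R v).
have yE w : y w = p w + d * (p w - (w == v)%:R) by [].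
have vs : v \in fset_set s by rewrite in_fset_set // inE.
have : std_simplex (fset_set s) y.
  rewrite -closed_simplexE //; apply: pe.
    rewrite -ball_normE /= /y opprD addrA subrr sub0r normrN normrZ gtr0_norm //.
    rewrite /d mulrAC ltr_pdivrMr ?mulr_gt0 // ltr_pM2l //.
    by move: N0; set c := `|_|; lra.
  apply/affine_hullP => //; split=> [w|].
    rewrite yE; case: (w =P v) => [-> //|_]; rewrite subr0.
    have [->|/ps //] := eqVneq (p w) 0; by rewrite mulr0 addr0 eqxx.
  under eq_bigr do rewrite yE.
  rewrite big_split /= p1 -big_distrr /= sumrB p1.
  rewrite (big_fsetD1 v) //= eqxx big_seq big1 ?addr0 ?subrr ?mulr0 ?addr0 // => w.
  by rewrite !inE => /andP[/negbTE ->].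
case=> /(_ v) + _ _; rewrite yE eqxx -pv0 add0r sub0r mulrN1 oppr_ge0.
by rewrite leNgt d0.
Qed.

(** The finitely many positive coordinates of [p] stay positive nearby, and within the affine hull
    of the support this is all that membership in the simplex asks. *)
Lemma std_simplex_support (s : {fset V}) (p : E) : std_simplex s p ->
  open_simplex (@vertex R V) [set v | p v != 0] p.
Proof.
move=> sp; have [p0 ps p1] := sp.
have fp : finite_set [set v | p v != 0].
  by apply: (@sub_finite_set _ _ [set` s]) => // v; exact: ps.
have pp : std_simplex (fset_set [set v | p v != 0]) p.
  by apply: std_simplexW sp _ => v pv; rewrite in_fset_set // inE.
split; first by rewrite closed_simplexE.
have : nbhs p (\bigcap_(v in [set` fset_set [set v | p v != 0]]) [set q : E | 0 < q v]).
  apply: filter_bigI => v; rewrite in_fset_set // inE /= => pv.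
  apply: (cvgr_gt _ (@continuous_free_coord v p)).
  by rewrite lt_neqAle eq_sym pv p0.
apply: filterS => y y0 /(affine_hullP _ fp)[ys y1].
rewrite closed_simplexE //; split=> // v.
have [->//|/ys vs] := eqVneq (y v) 0.
by apply: ltW; exact: y0.
Qed.

Lemma closed_std_simplex (s : {fset V}) : closed (std_simplex s).
Proof.
have -> : std_simplex s = \bigcap_v [set p : E | 0 <= p v] `&`
    \bigcap_(v in [set v | v \notin s]) [set p : E | p v = 0] `&`
    [set p : E | \sum_(v <- s) p v = 1].
  apply/seteqP; split=> [p [p0 ps p1]|p [[p0 ps] p1]]; split=> //.
  - by split=> [v _|v /= vs]; [exact: p0|apply/eqP; apply: contraNT vs; exact: ps].
  - by move=> v; exact: p0.
  - by move=> v pv; apply: contraNT pv => /ps /= ->.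
apply: closedI; first apply: closedI.
- apply: closed_bigI => v _.
  by have /continuous_closedP/(_ _ (@closed_ge R 0)) := continuous_free_coord (v := v).
- apply: closed_bigI => v _.
  by have /continuous_closedP/(_ _ (@closed_eq R 0)) := continuous_free_coord (v := v).
- have /continuous_closedP/(_ _ (@closed_eq R 1)) : continuous (fun p : E => \sum_(v <- s) p v).
    apply: continuous_big; first exact: add_continuous.
    by move=> v _; exact: continuous_free_coord.
  by [].
Qed.

End free_space_simplex.

(** * Canonical maps *)

Section canonical_partition.
Variables (R : realType) (X : topologicalType).
Hypotheses (pcX : paracompact X) (hdX : hausdorff_space X).

(** The normalised functions are the coefficients of the vertices [vtx k x], and [p] is continuous
    because the active labels are constant near [x]. That all nearby values lie in one simplex is
    what later gives continuity into the Whitehead topology, and of composites with maps continuous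
    on each simplex separately. *)
Lemma canonical_partition (T : choiceType) (n : nat) (Q : nat -> set X)
    (vtx : nat -> X -> T) :
  (forall k, open (Q k)) -> \bigcup_(k in [set k | (k <= n)%N]) Q k = [set: X] ->

  (forall k x, Q k x -> \forall z \near x, vtx k z = vtx k x) ->
  exists p : X -> free_space R T, continuous p /\
    forall x, exists s : {fset T}, (\forall z \near x, std_simplex s (p z)) /\
      forall v, v \in s -> exists k, [/\ (k <= n)%N, Q k x & v = vtx k x].
Proof.
move=> oQ cQ vtxQ.
have [||H [oH HQ cH _]] := @paracompact_shrinking X pcX hdX nat
    (fun k => if (k <= n)%N then Q k else set0).
- by move=> k; case: ifP => _ //; exact: open0.
- move=> x; have : setT x by []. rewrite -cQ => -[k /= kn Qx].
  by exists k; rewrite kn.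
have [u [cu u01 uH _ u1]] := urysohn_partition R pcX hdX oH cH.
have uQ k x : u k x != 0 -> (k <= n)%N /\ Q k x.
  by move=> /uH /subset_closure /HQ; case: ifP.
pose D x := \sum_(k <- iota 0 n.+1) u k x.
have u0 k x : 0 <= u k x by have /andP[] := u01 k x.
have D0 x : 0 < D x.
  have [k uk] := u1 x; have [kn _] : (k <= n)%N /\ Q k x.
    by apply: uQ; rewrite uk oner_neq0.
  rewrite /D (big_rem k); last by rewrite mem_iota add0n ltnS.
  by rewrite uk ltr_pwDl // sumr_ge0.
have cD : continuous D.
  by apply: continuous_big; [exact: add_continuous|move=> k _; exact: cu].
pose r k x := u k x / D x.
have cr k : continuous (r k).
  move=> x; apply: cvgM; first exact: cu.
  by apply: cvgV; [rewrite gt_eqF|exact: cD].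
pose p x : free_space R T := \sum_(k <- iota 0 n.+1) r k x *: vertex R (vtx k x).
(* Closures make the choice stable: if [x] is outside the closure of [H k], the index [k] is
   inactive on a whole neighbourhood of [x]. *)
pose s x : {fset T} :=
  [fset vtx k x | k in fset_set (`I_n.+1 `&` [set k | closure (H k) x])]%fset.
have fJ x : finite_set (`I_n.+1 `&` [set k | closure (H k) x]).
  by apply: finite_setIl; exact: finite_II.
have near_p x : \forall z \near x, p z = \sum_(k <- iota 0 n.+1) r k z *: vertex R (vtx k x)
    /\ forall k, (k <= n)%N -> r k z != 0 -> vtx k x \in s x.
  have : nbhs x (\bigcap_(k in [set` fset_set `I_n.+1])
      [set z | if `[< closure (H k) x >] then vtx k z = vtx k x else ~ H k z]).
    apply: filter_bigI => k; rewrite in_fset_set ?inE /= ?ltnS => [kn|]; last exact: finite_II.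
    case: asboolP => [/HQ|nH]; first by rewrite kn => /vtxQ.
    apply: filterS (open_nbhs_nbhs (conj _ nH) : nbhs x (~` closure (H k))).
      by move=> z nz Hz; apply: nz; exact: subset_closure.
    by rewrite openC; exact: closed_closure.
  apply: filterS => z Hz.
  have Hz' k : (k <= n)%N -> if `[< closure (H k) x >] then vtx k z = vtx k x else ~ H k z.
    by move=> kn; apply: Hz; rewrite /= in_fset_set ?inE //; exact: finite_II.
  have r0 k : (k <= n)%N -> r k z != 0 -> `[< closure (H k) x >] /\ vtx k z = vtx k x.
    move=> kn; rewrite mulf_eq0 negb_or => /andP[/uH Hkz _].
    by have := Hz' k kn; case: asboolP.
  split.
    rewrite /p big_seq [RHS]big_seq; apply: eq_bigr => k.
    rewrite mem_iota add0n ltnS => /= kn.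
    have [->|/(r0 k kn)[_ ->] //] := eqVneq (r k z) 0; by rewrite !scale0r.
  move=> k kn /(r0 k kn)[/asboolP cl _]; apply/imfsetP; exists k => //.
  by rewrite in_fset_set // inE.
exists p; split.
  move=> x; apply: (@continuous_near_eq _ _ _
      (fun z => \sum_(k <- iota 0 n.+1) r k z *: vertex R (vtx k x))).
    by apply: filterS (near_p x) => z [].
  by apply: cvg_free_sum => k; exact: cr.
move=> x; exists (s x); split.
  apply: filterS (near_p x) => z [-> rs].
  rewrite big_seq; apply: std_simplex_combination.
  - by move=> k _; rewrite divr_ge0 // ltW ?D0.
  - by move=> k; rewrite mem_iota add0n ltnS => /= kn; exact: rs.
  - by rewrite -big_seq -big_distrl /= divff // gt_eqF ?D0.
move=> v /imfsetP[k + ->]; rewrite in_fset_set // inE => -[/= kn clH].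
by exists k; split=> //; have := HQ k x clH; rewrite -ltnS kn.
Qed.

(** Each disjoint piece is assigned a member of [U] containing it; the label is locally constant
    because the pieces are open and disjoint. *)
Lemma disjointly_refines_label (U : set (set X)) (Q : set X) :
  disjointly_refines U Q -> exists l : X -> set X, forall x, Q x ->
    [/\ U (l x), l x x & \forall z \near x, l z = l x].
Proof.
move=> [V [oV tV rV <-]].
have /choice[b Hb] : forall A, exists B, V A -> U B /\ A `<=` B.
  move=> A; have [/rV[B UB AB]|nV] := pselect (V A); first by exists B.
  by exists set0.
have /choice[a Ha] : forall x, exists A, (\bigcup_(A in V) A) x -> V A /\ A x.
  move=> x; have [[A VA Ax]|nx] := pselect ((\bigcup_(A in V) A) x); first by exists A.
  by exists set0.
exists (b \o a) => x /Ha[VA Ax]; have [UB AB] := Hb _ VA; split=> //=.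
  exact: AB.
apply: filterS (open_nbhs_nbhs (conj (oV _ VA) Ax)) => z Az /=; congr b.
have [VA' Az'] : V (a z) /\ a z z by apply: Ha; exists (a x).
by apply: tV => //; exists z.
Qed.

Lemma whitehead_openE (E : normedModType R) (V : Type) (e : V -> E) (K : complex V)
  (A : set (realisation e K)) : open A = whitehead_open A.
Proof. by []. Qed.

Lemma finite_C_canonical_map (U : nat -> set (set X)) :
  finite_C_space X -> (forall k, open_cover (U k)) ->
  exists (n : nat) (f : X -> Delta_space R U n), canonical_map f.
Proof.
move=> finC oU.
have [n [Q [dQ cQ]]] := finite_C_disjointly_refines R pcX hdX finC oU.
have /choice[l Hl] := fun k => disjointly_refines_label (dQ k).
have [|||p [cp Hp]] := @canonical_partition (set X * nat)%type n Q
    (fun k x => (l k x, k)).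
- by move=> k; exact: disjointly_refines_open (dQ k).
- exact: cQ.

- by move=> k x /Hl[_ _]; apply: filterS => z ->.
have simplex_s x (s : {fset set X * nat}) : std_simplex s (p x) ->
    (forall v, v \in s -> exists k, [/\ (k <= n)%N, Q k x & v = (l k x, k)]) ->
    simplices (Delta U n) [set` s].
  move=> [_ ps p1] Hs; split; last first.
    by move=> i j /Hs[k [_ _ ->]] /Hs[k' [_ _ ->]] /= ->.
  split=> //.
  - have [v vs] : exists v, v \in s.
      apply/fset0Pn; apply/eqP => s0; move: p1; rewrite s0 big_nil.
      by move/eqP; rewrite eq_sym oner_eq0.
    by exists v.
  - by move=> i /Hs[k [kn /Hl[Uk _ _] ->]].
  - by exists x => i /Hs[k [kn /Hl[_ lx _] ->]].
have polp x : polyhedron (@vertex R (set X * nat)%type) (Delta U n) (p x).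
  have [s [near_s Hs]] := Hp x; have sp := nbhs_singleton near_s.
  exists [set` s]; first exact: simplex_s sp Hs.
  by rewrite closed_simplexE // set_fsetK.
pose f x : Delta_space R U n := exist _ (p x) (polp x).
exists n, f; split.
  (* Near [x] the values stay in one closed simplex, on which a Whitehead-open set is the trace of a
     norm-open [W]. *)
  apply/continuousP => A; rewrite whitehead_openE => oA; rewrite openE => x Ax.
  have [s [near_s Hs]] := Hp x; have sp := nbhs_singleton near_s.
  have [W oW AW] := oA _ (simplex_s x s sp Hs).
  have sE y : closed_simplex (@vertex R (set X * nat)%type) [set` s] (p y) =
      std_simplex s (p y) by rewrite closed_simplexE // set_fsetK.
  have Wx : W (p x).
    have : (A `&` @realisation_val _ _ _ _ _ @^-1`
      closed_simplex (@vertex R (set X * nat)%type) [set` s]) (f x).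
      by split=> //=; rewrite /realisation_val /= sE.
    by rewrite AW => -[].
  have near_W : \forall z \near x, W (p z).
    by apply: cp; exact: open_nbhs_nbhs.
  rewrite /interior; apply: filterS2 near_s near_W => z sz Wz.
  have : (realisation_val (K:=Delta U n) @^-1` (W `&`
      closed_simplex (@vertex R (set X * nat)%type) [set` s])) (f z).
    by split=> //; rewrite /realisation_val /= sE.
  by rewrite -AW => -[].
move=> i _ x [t [[[ft _ _ _] _] ti]].
rewrite /realisation_val /= => pt.
have pi : 0 < p x i := open_simplex_gt0 ft ti pt.
have [s [near_s Hs]] := Hp x; have [_ ps _] := nbhs_singleton near_s.
have /Hs[k [kn /Hl[_ lx _] iE]] : i \in s by apply: ps; rewrite gt_eqF.
by rewrite iE.
Qed.

(** The open star of [(A, k)] appears as the set where that coordinate is positive. Two such sets of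
    the same level are disjoint because a simplex of [Delta U n] has at most one vertex per
    level. *)
Lemma canonical_map_finite_C :
  (forall U : nat -> set (set X), (forall k, open_cover (U k)) ->
    exists (n : nat) (f : X -> Delta_space R U n), canonical_map f) ->
  finite_C_space X.
Proof.
move=> cmap; split; first exact: (paracompact_normal_space pcX hdX R).
move=> U HU; have [k|n [f [cf stf]]] := cmap U; first by have [] := HU k.
pose p x : free_space R (set X * nat)%type := realisation_val (f x).
have Hp x : exists s, simplices (Delta U n) s /\ std_simplex (fset_set s) (p x).
  have [s Ks sp] := svalP (f x); exists s; split=> //.
  by rewrite -closed_simplexE //; have [[]] := Ks.
have supp x i : 0 < p x i -> is_index U n i /\ i.1 x.
  move=> pi; have [s [Ks sp]] := Hp x; have [[fs s0 sU [y sy]] s1] := Ks.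
  have [_ ps _] := sp.
  have psi v : p x v != 0 -> s v by move=> /ps; rewrite in_fset_set // inE.
  have si : s i by apply: psi; rewrite gt_eqF.
  split; first exact: sU.
  apply: stf.
    by apply: simplex_sub Ks _ _ => [_ -> //|]; exists i.
  exists [set v | p x v != 0]; last exact: std_simplex_support sp.
  split; last by rewrite /= gt_eqF.
  by apply: simplex_sub Ks psi _; exists i; rewrite /= gt_eqF.
have open_pos i : open [set x | 0 < p x i].
  pose A : set (Delta_space R U n) := [set y |
    0 < (realisation_val y : free_space R (set X * nat)%type) i].
  suff oA : open A by move/continuousP: cf => /(_ A oA).
  rewrite whitehead_openE => s Ks; exists [set q : free_space R (set X * nat)%type | 0 < q i].
    rewrite openE => q q0; rewrite /interior.
    exact: (cvgr_gt _ (@continuous_free_coord R _ i q)).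
  by [].
exists n, (fun k => [set B | exists2 A, U k A & B = [set x | 0 < p x (A, k)]]).
split=> [k kn|].
  split.
  - by move=> _ [A UA ->]; exact: open_pos.
  - move=> _ _ [A UA ->] [B UB ->] [x [/= pA pB]].
    have [s [[[fs _ _ _] s1] [_ ps _]]] := Hp x.
    have psi v : 0 < p x v -> s v.
      by move=> pv; have := ps v; rewrite in_fset_set // inE gt_eqF //; apply.
    by have [->] := s1 _ _ (psi _ pA) (psi _ pB) erefl.
  - by move=> _ [A UA ->]; exists A => // x /= /supp[].
apply/seteqP; split=> // x _; have [s [Ks [p0 ps p1]]] := Hp x.
have [[A k] pA] : exists i, 0 < p x i.
  apply: contrapT => np; have : \sum_(v <- fset_set s) p x v = 0.
    apply: big1 => v _; apply/eqP; apply: contrapT => /negP pv; apply: np.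
    by exists v; rewrite lt_neqAle eq_sym pv p0.
  by rewrite p1 => /eqP; rewrite oner_eq0.
have [[/= UA kn] _] := supp _ _ pA.
by exists k => //; exists [set x | 0 < p x (A, k)] => //; exists A.
Qed.

End canonical_partition.

(** * From selections to the C-property *)

Section euclidean_norm.
Variables (R : realType) (k : nat).
Implicit Type z : 'rV[R]_k.+1.

Definition enorm z : R := Num.sqrt (\sum_(i < k.+1) z 0 i ^+ 2).

Lemma enorm_ge0 z : 0 <= enorm z. Proof. exact: sqrtr_ge0. Qed.

Lemma sum_sqr_ge0 z : 0 <= \sum_(i < k.+1) z 0 i ^+ 2.
Proof. by apply: sumr_ge0 => i _; exact: sqr_ge0. Qed.

Lemma enorm_eq0 z : (enorm z == 0) = (z == 0).
Proof.
rewrite sqrtr_eq0 le_eqVlt ltNge sum_sqr_ge0 orbF psumr_eq0; last first.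
  by move=> i _; exact: sqr_ge0.
apply/allP/eqP => [z0|-> i _ /=]; last by rewrite mxE expr0n.
apply/rowP => i; rewrite mxE; have := z0 i (mem_index_enum i).
by rewrite /= sqrf_eq0 => /eqP.
Qed.

Lemma enormZ (a : R) z : enorm (a *: z) = `|a| * enorm z.
Proof.
rewrite /enorm -sqrtr_sqr -sqrtrM ?sqr_ge0 // big_distrr /=; congr Num.sqrt.
by apply: eq_bigr => i _; rewrite mxE exprMn.
Qed.

Lemma continuous_enorm : continuous enorm.
Proof.
have c1 : continuous (fun z : 'rV[R]_k.+1 => \sum_(i < k.+1) z 0 i ^+ 2).
  apply: continuous_big => [|i _ z]; first exact: add_continuous.
  apply: (@continuous_comp _ _ _ (fun z : 'rV[R]_k.+1 => z 0 i) (fun x : R => x ^+ 2)).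
    exact: coord_continuous.
  exact: exprn_continuous.
move=> z; apply: (@continuous_comp _ _ _ _ (@Num.sqrt R)); first exact: c1.
exact: sqrt_continuous.
Qed.

Lemma sphereE z : @sphere R k z <-> enorm z = 1.
Proof.
rewrite /sphere /=; split=> [H|H]; first by rewrite /enorm H sqrtr1.
by rewrite -[LHS]sqr_sqrtr ?sum_sqr_ge0 // -/(enorm z) H expr1n.
Qed.

Lemma solid_ballE z : @solid_ball R k z <-> enorm z <= 1.
Proof.
rewrite /solid_ball /= -{1}(sqr_sqrtr (sum_sqr_ge0 z)) -/(enorm z).
by rewrite expr_le1 // enorm_ge0.
Qed.

Lemma enorm_normalize z : z != 0 -> enorm ((enorm z)^-1 *: z) = 1.
Proof.
move=> z0; rewrite enormZ ger0_norm ?invr_ge0 ?enorm_ge0 // mulVf //.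
by rewrite enorm_eq0.
Qed.

Lemma coord_le_enorm z i : `|z 0 i| <= enorm z.
Proof.
rewrite -sqrtr_sqr ler_sqrt ?sum_sqr_ge0 // (bigD1 i) //= lerDl.
by apply: sumr_ge0 => j _; exact: sqr_ge0.
Qed.

Lemma compact_solid_ball : compact (@solid_ball R k).
Proof.
apply: bounded_closed_compact.
  exists 1; split=> // M M1 z /solid_ballE z1.
  rewrite /= [leLHS]/Num.norm /= mx_normrE; apply/bigmax_leP; split; first by rewrite ltW // (lt_trans _ M1).
  move=> [i j] _ /=; rewrite (ord1 i).
  by apply: le_trans (coord_le_enorm z j) _; apply: le_trans z1 _; exact: ltW.
have -> : @solid_ball R k = enorm @^-1` [set x | x <= 1].
  by apply/seteqP; split=> z /solid_ballE.
by have /continuous_closedP/(_ _ (@closed_le R 1)) := continuous_enorm.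
Qed.

End euclidean_norm.

Section selection_finite_C.
Variables (R : realType).

Lemma std_simplex_norm (V : choiceType) (s : {fset V}) (p : free_space R V) :
  std_simplex s p -> `|p| = 1.
Proof.
move=> [p0 ps p1]; rewrite [LHS](@free_normE _ _ p [set` s]) //.
rewrite fsbig_finite //= set_fsetK -[RHS]p1; apply: eq_bigr => v _.
by rewrite ger0_norm.
Qed.

Lemma std_simplex_convex (V : choiceType) (s : {fset V}) (a : R)
    (p q : free_space R V) : 0 <= a <= 1 -> std_simplex s p -> std_simplex s q ->
  std_simplex s (a *: p + (1 - a) *: q).
Proof.
move=> /andP[a0 a1] [p0 ps p1] [q0 qs q1].
have E v : (a *: p + (1 - a) *: q) v = a * p v + (1 - a) * q v by [].
split=> [v|v|].
- by rewrite E addr_ge0 // mulr_ge0 // subr_ge0.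
- rewrite E; have [->|/ps //] := eqVneq (p v) 0.
  by have [->|/qs //] := eqVneq (q v) 0; rewrite !mulr0 addr0 eqxx.
- under eq_bigr do rewrite E.
  by rewrite big_split /= -!big_distrr /= p1 q1 !mulr1 addrC subrK.
Qed.

(** The cone over [g] with apex [w], with value [|z| g(z/|z|) + (1 - |z|) w]. It is continuous at
    the centre because points of simplices have norm 1, so the term with [g] tends to 0. The
    singleton alternative accounts for the centre, which goes to the apex. *)
Lemma cone_extends (V : choiceType) (k : nat) (w : V)
    (S : set {fset V}) (g : 'rV[R]_k.+1 -> free_space R V) :
  {within @sphere R k, continuous g} ->
  (forall z, @sphere R k z -> exists2 s, S s & std_simplex s (g z)) ->
  exists h : 'rV[R]_k.+1 -> free_space R V,
    [/\ continuous h,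
        forall z, @solid_ball R k z -> std_simplex [fset w]%fset (h z) \/
          exists2 s, S s & std_simplex (w |` s)%fset (h z) &
        forall z, @sphere R k z -> h z = g z].
Proof.
move=> cg gS.
pose u (z : 'rV[R]_k.+1) := (enorm z)^-1 *: z.
pose h z : free_space R V := enorm z *: g (u z) + (1 - enorm z) *: vertex R w.
exists h; split.
- move=> z0; rewrite /continuous_at.
  have FF : Filter (nbhs z0) by exact: nbhs_filter.
  have [z00|z0n] := eqVneq z0 0; last first.
    have en0 : enorm z0 != 0 by rewrite enorm_eq0.
    have near0 : \forall z \near z0, z != 0.
      have : \forall z \near z0, 0 < enorm z.
        apply: (cvgr_gt _ (@continuous_enorm R k z0)).
        by rewrite lt_neqAle eq_sym en0 enorm_ge0.
      by apply: filterS => z; rewrite -enorm_eq0; exact: lt0r_neq0.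
    have cu : u z @[z --> z0] --> u z0.
      apply: cvgZ; last exact: cvg_id.
      by apply: cvgV => //; exact: continuous_enorm.
    have su : @sphere R k (u z0) by apply/sphereE; exact: enorm_normalize.
    have cgu : g (u z) @[z --> z0] --> g (u z0).
      move/subspace_continuousP: cg => /(_ _ su) cg'.
      apply: (@cvg_comp _ _ _ u g _ _ _ _ cg') => A /= wA.
      have : \forall z \near z0, @sphere R k (u z) -> A (u z) by exact: (cu _ wA).
      apply: filterS2 near0 => z zn Az; apply: Az.
      by apply/(sphereE (u z)); exact: enorm_normalize.
    apply: cvgD; apply: cvgZ => //; [exact: continuous_enorm| |exact: cvg_cst].
    by apply: cvgB; [exact: cvg_cst|exact: continuous_enorm].
  rewrite z00 in FF *; have -> : h 0 = vertex R w.
    rewrite /h; have -> : enorm (0 : 'rV[R]_k.+1) = 0 by apply/eqP; rewrite enorm_eq0.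
    by rewrite scale0r add0r subr0 scale1r.
  apply/cvgrPdist_lt => e e0.
  have : \forall z \near (0 : 'rV[R]_k.+1), enorm z < e / 2.
    apply: (cvgr_lt _ (@continuous_enorm R k 0)).
    have -> : enorm (0 : 'rV[R]_k.+1) = 0 by apply/eqP; rewrite enorm_eq0.
    by rewrite divr_gt0.
  apply: filterS => z ze.
  have [->|zn] := eqVneq z 0.
    rewrite /h; have -> : enorm (0 : 'rV[R]_k.+1) = 0 by apply/eqP; rewrite enorm_eq0.
    by rewrite scale0r add0r subr0 scale1r subrr normr0.
  have -> : vertex R w - h z = enorm z *: (vertex R w - g (u z)).
    by rewrite /h scalerBl scale1r scalerBr opprD opprB addrC -addrA subrK addrC.
  have [s _ /std_simplex_norm g1] : exists2 s, S s & std_simplex s (g (u z)).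
    by apply: gS; apply/sphereE; exact: enorm_normalize.
  have w1 : `|vertex R w| = 1.
    by apply: (@std_simplex_norm _ [fset w]%fset); apply: std_simplex_vertex; rewrite inE.
  rewrite normrZ ger0_norm ?enorm_ge0 //.
  apply: (@le_lt_trans _ _ (enorm z * 2)); last by rewrite -ltr_pdivlMr.
  rewrite ler_wpM2l ?enorm_ge0 //; apply: le_trans (ler_normB _ _) _.
  by rewrite w1 g1.
- move=> z /solid_ballE z1; have [->|zn] := eqVneq z 0.
    left; rewrite /h; have -> : enorm (0 : 'rV[R]_k.+1) = 0.
      by apply/eqP; rewrite enorm_eq0.
    rewrite scale0r add0r subr0 scale1r.
    by apply: std_simplex_vertex; rewrite inE.
  have [s Ss gs] : exists2 s, S s & std_simplex s (g (u z)).
    by apply: gS; apply/sphereE; exact: enorm_normalize.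
  right; exists s => //; apply: std_simplex_convex.
  + by rewrite enorm_ge0.
  + by apply: std_simplex_sub gs => v vs; rewrite !inE vs orbT.
  + by apply: std_simplex_vertex; rewrite !inE eqxx.
- move=> z /sphereE z1.
  by rewrite /h /u z1 invr1 !scale1r subrr scale0r addr0.
Qed.

Variable X : topologicalType.
Hypotheses (pcX : paracompact X) (hdX : hausdorff_space X).

Lemma selection_finite_C :
  (forall (Y : topologicalType) (phi : nat -> X -> set Y),
    hausdorff_space Y ->
    (forall k x, phi k x !=set0) ->
    (forall k, lower_locally_constant (phi k)) ->
    aspherical R phi ->
    exists (n : nat) (f : X -> Y), continuous f /\ selection (phi n) f) ->
  finite_C_space X.
Proof.
move=> sel; split; first exact: (paracompact_normal_space pcX hdX R).
move=> U HU; pose T := (set X * nat)%type.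
(* The simplices of [Delta U k] whose members all contain [x], together with the empty set, which
   spans no point. *)
pose adm k x : set {fset T} := [set s : {fset T} |
  (forall v, v \in s -> [/\ (v.2 <= k)%N, U v.2 v.1 & v.1 x]) /\
  (forall v w, v \in s -> w \in s -> v.2 = w.2 -> v = w)].
pose phi k x : set (free_space R T) := [set p | exists2 s, adm k x s & std_simplex s p].
have covU k x : exists2 A, U k A & A x.
  have [[_ cU] _] := HU k; have : setT x by []. by rewrite -cU => -[A UA Ax]; exists A.
have adm1 k j x A : (j <= k)%N -> U j A -> A x -> adm k x [fset (A, j)]%fset.
  move=> jk UA Ax; split=> [v|v w]; first by rewrite inE => /eqP ->.
  by rewrite !inE => /eqP -> /eqP ->.
have [||||n [f [cf sf]]] := sel (free_space R T) phi.
- exact: norm_hausdorff.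
- move=> k x; have [A UA Ax] := covU 0%N x.
  exists (vertex R (A, 0%N)), [fset (A, 0%N)]%fset; first exact: adm1.
  by apply: std_simplex_vertex; rewrite inE.
(* The covers being finite, finitely many indices up to level [k] have members containing [x], and
   these members contain every nearby [z]; thus [phi k x] is included in [phi k z]. *)
- move=> k K _; rewrite openE => x Kx.
  have finN : finite_set [set v : T | [/\ (v.2 <= k)%N, U v.2 v.1 & v.1 x]].
    apply: (@sub_finite_set _ _ (\bigcup_(j in `I_k.+1) ((fun A => (A, j)) @` U j))).
      by move=> [A j] /= [jk UA _]; exists j => //; exists A.
    apply: bigcup_finite => [|j _]; first exact: finite_II.
    by apply: finite_image; have [] := HU j.
  have : nbhs x (\bigcap_(v in [set` fset_set [set v : T |
      [/\ (v.2 <= k)%N, U v.2 v.1 & v.1 x]]]) v.1).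
    apply: filter_bigI => v; rewrite in_fset_set // inE => -[_ Uv vx].
    by apply: open_nbhs_nbhs; split=> //; have [[oU _] _] := HU v.2; exact: oU.
  apply: filterS => z Hz p /Kx[s [s1 s2] sp]; exists s => //; split=> // v vs.
  have [vk Uv vx] := s1 v vs; split=> //.
  by apply: (Hz v); rewrite /= in_fset_set // inE.
(* The apex is taken from the cover [k.+1], so it shares its level with no vertex of an admissible
   set for [k]. *)
- move=> k x g cg gS; have [A UA Ax] := covU k.+1 x.
  have [|h [ch hS hg]] := @cone_extends T k (A, k.+1) (adm k x) g cg.
    by move=> z sz; apply: gS; exists z.
  exists h; split=> //; first exact: continuous_subspaceT.
  move=> _ [z /hS[hz|[s [s1 s2] hz]] <-].
    by exists [fset (A, k.+1)]%fset => //; exact: adm1.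
  exists ((A, k.+1) |` s)%fset => //; split=> [v|v w].
    rewrite !inE => /orP[/eqP -> //|/s1[vk ? ?]]; split=> //; exact: leq_trans vk _.
  rewrite !inE => /orP[/eqP ->|vs] /orP[/eqP ->|ws] //=; last exact: s2.
    by move=> wk; have [] := s1 w ws; rewrite -wk ltnn.
  by move=> vk; have [] := s1 v vs; rewrite vk ltnn.
have pos x v : 0 < f x v -> [/\ (v.2 <= n)%N, U v.2 v.1 & v.1 x].
  have [s [s1 _] [_ ps _]] := sf x; move=> fv; apply: s1; apply: ps; by rewrite gt_eqF.
exists n, (fun k => [set B | exists2 A, U k A & B = [set x | 0 < f x (A, k)]]).
split=> [k kn|].
  split.
  - move=> _ [A UA ->]; rewrite openE => x fx; rewrite /interior.
    have cfx : f y (A, k) @[y --> x] --> f x (A, k).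
      exact: (cvg_comp _ _ (cf x) (@continuous_free_coord R _ (A, k) (f x))).
    exact: (cvgr_gt _ cfx).
  - move=> _ _ [A UA ->] [B UB ->] [x [/= fA fB]].
    have [s [_ s2] [_ ps _]] := sf x.
    have psi v : 0 < f x v -> v \in s by move=> fv; apply: ps; rewrite gt_eqF.
    by have [->] := s2 _ _ (psi _ fA) (psi _ fB) erefl.
  - by move=> _ [A UA ->]; exists A => // x /= /pos[].
apply/seteqP; split=> // x _; have [s _ [p0 ps p1]] := sf x.
have [[A k] fA] : exists i, 0 < f x i.
  apply: contrapT => np; have : \sum_(v <- s) f x v = 0.
    apply: big1 => v _; apply/eqP; apply: contrapT => /negP pv; apply: np.
    by exists v; rewrite lt_neqAle eq_sym pv p0.
  by rewrite p1 => /eqP; rewrite oner_eq0.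
have [/= kn UA Ax] := pos _ _ fA.
by exists k => //; exists [set x | 0 < f x (A, k)] => //; exists A.
Qed.

End selection_finite_C.

(** * Extending maps from the boundary of a simplex *)

Lemma within_continuous_comp (X Y Z : topologicalType) (A : set X) (B : set Y)
    (f : X -> Y) (g : Y -> Z) : (forall x, A x -> B (f x)) ->
  (forall x, A x -> {for x, continuous f}) ->
  {within B, continuous g} -> {within A, continuous (g \o f)}.
Proof.
move=> AB cf /subspace_continuousP cg; apply/subspace_continuousP => x Ax.
apply: (@cvg_comp _ _ _ f g _ _ _ _ (cg _ (AB x Ax))) => W /= wW.
have : \forall y \near x, B (f y) -> W (f y) by exact: (cf x Ax _ wW).
by apply: filterS => y BW Ay; apply: BW; exact: AB.
Qed.

Lemma continuous_bigmax (R : realType) (X : topologicalType) (I : Type)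
    (r : seq I) (f : I -> X -> R) (x : X) :
  (forall i, {for x, continuous (f i)}) ->
  {for x, continuous (fun x => \big[Num.max/0]_(i <- r) f i x)}.
Proof.
move=> cf; elim: r => [|i r IH].
  have -> : (fun y => \big[Num.max/0]_(j <- [::]) f j y) = cst 0.
    by apply/funext => y; rewrite big_nil.
  exact: cst_continuous.
have -> : (fun y => \big[Num.max/0]_(j <- i :: r) f j y) =
    f i \max (fun y => \big[Num.max/0]_(j <- r) f j y).
  by apply/funext => y; rewrite big_cons.
exact: continuous_max.
Qed.

Section extend_boundary.
Variables (R : realType) (V : choiceType) (k : nat) (s : {fset V}) (v0 : V).
Hypothesis cards : #|` s| = k.+2.
Local Notation E := (free_space R V).

Definition simplex_boundary : set E :=
  [set p | std_simplex s p /\ exists2 v, v \in s & p v = 0].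

Let a (i : nat) := nth v0 s i.
(** The common value of the barycentric coordinates of the barycentre. *)
Let c : R := (k.+2)%:R^-1.

Let sizes : size s = k.+2. Proof. exact: cards. Qed.

Let as_ i : (i < k.+2)%N -> a i \in s.
Proof. by move=> ik; rewrite mem_nth // sizes. Qed.

Let c_gt0 : 0 < c. Proof. by rewrite invr_gt0 ltr0n. Qed.

Let kc : k.+1%:R * c + c = 1.
Proof. by rewrite -[X in _ + X]mul1r -mulrDl natr1 mulfV // pnatr_eq0. Qed.

Let sumsE (F : V -> R) :
  \sum_(v <- s) F v = \sum_(i < k.+1) F (a i) + F (a k.+1).
Proof. by rewrite (big_nth v0) big_mkord sizes big_ord_recr. Qed.

Let indexs v : v \in s -> exists2 i, (i < k.+2)%N & v = a i.
Proof.
move=> vs; exists (index v s); first by rewrite -sizes index_mem.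
by rewrite /a nth_index.
Qed.

(** The displacement from the barycentre. The last coordinate is left out, being determined by the
    others. *)
Let L (p : E) : 'rV[R]_k.+1 := \row_i (p (a i) - c).

Let mu (p : E) : R := \prod_(i < k.+2) p (a i).

(* Radial projection of the simplex onto the ball, smoothed by [mu], which is
   positive at the barycentre and vanishes exactly on the boundary. *)
Let to_ball (p : E) : 'rV[R]_k.+1 := (enorm (L p) + mu p)^-1 *: L p.

(** Restores the omitted last coordinate of a displacement: all [k.+2] coordinates sum to zero. *)
Let zeta (z : 'rV[R]_k.+1) (i : nat) : R :=
  if (i < k.+1)%N then z 0 (inord i) else - \sum_j z 0 j.

Let m (z : 'rV[R]_k.+1) : R := \big[Num.max/0]_(i < k.+2) - zeta z i.

(* Rays from the barycentre in direction [zeta z] leave the simplex at the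
   parameter [c / m z]. *)
Let of_sphere (z : 'rV[R]_k.+1) : E :=
  \sum_(i < k.+2) (c * (1 + zeta z i / m z)) *: vertex R (a i).

Let mu_ge0 p : std_simplex s p -> 0 <= mu p.
Proof. by move=> [p0 _ _]; apply: prodr_ge0. Qed.

(** [L p] vanishes only at the barycentre, where [mu p] is a power of [c]. *)
Let denom_gt0 p : std_simplex s p -> 0 < enorm (L p) + mu p.
Proof.
move=> sp; have [p0 ps p1] := sp.
have [Lp0|Ln0] := eqVneq (enorm (L p)) 0; last first.
  by rewrite ltr_pwDl ?mu_ge0 // lt_neqAle eq_sym Ln0 enorm_ge0.
rewrite Lp0 add0r; have pc (i : 'I_k.+1) : p (a i) = c.
  move/eqP: Lp0; rewrite enorm_eq0 => /eqP /rowP /(_ i).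
  by rewrite !mxE => /eqP; rewrite subr_eq0 => /eqP.
have pl : p (a k.+1) = c.
  move: p1; rewrite sumsE; under eq_bigr do rewrite pc.
  rewrite sumr_const card_ord -mulr_natl -{2}kc => /addrI.
  by [].
rewrite /mu; apply: prodr_gt0 => i _.
have [ik|] := ltnP i k.+1; first by rewrite (pc (Ordinal ik)).
move=> ki; have -> : nat_of_ord i = k.+1; last by rewrite pl.
by apply/eqP; rewrite eqn_leq ki andbT -ltnS ltn_ord.
Qed.

Let to_ball_le1 p : std_simplex s p -> solid_ball (to_ball p).
Proof.
move=> sp; have d0 := denom_gt0 sp; apply/solid_ballE.
rewrite enormZ ger0_norm ?invr_ge0 ?(ltW d0) // mulrC ler_pdivrMr // mul1r.
by rewrite lerDl mu_ge0.
Qed.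

Let mu_boundary p : simplex_boundary p -> mu p = 0.
Proof.
move=> [_ [v /indexs[i ik ->] pv]].
by rewrite /mu (bigD1 (Ordinal ik)) //= pv mul0r.
Qed.

Let to_ball_boundary p : simplex_boundary p -> sphere (to_ball p).
Proof.
move=> bp; have d0 := denom_gt0 (proj1 bp); apply/sphereE.
rewrite enormZ ger0_norm ?invr_ge0 ?(ltW d0) //.
by move: d0; rewrite mu_boundary // addr0 => d0; rewrite mulVf // gt_eqF.
Qed.

Let continuous_to_ball p : std_simplex s p -> {for p, continuous to_ball}.
Proof.
move=> sp; have d0 := denom_gt0 sp.
have cL : continuous L.
  have -> : L = fun p => \sum_(i < k.+1) (p (a i) - c) *: delta_mx 0 i.
    apply/funext => q; rewrite {1}(row_sum_delta (L q)).
    by apply: eq_bigr => i _; rewrite mxE.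
  apply: continuous_big => [|i _ q]; first exact: add_continuous.
  rewrite /continuous_at; have FF : Filter (nbhs q) by exact: nbhs_filter.
  apply: cvgZ; last exact: cvg_cst.
  by apply: cvgB; [exact: continuous_free_coord|exact: cvg_cst].
have cmu : continuous mu.
  apply: continuous_big => [|i _]; first exact: mul_continuous.
  exact: continuous_free_coord.
rewrite /continuous_at; have FF : Filter (nbhs p) by exact: nbhs_filter.
apply: cvgZ; last exact: cL.
apply: cvgV; first by rewrite gt_eqF.
apply: cvgD; last exact: cmu.
exact: (cvg_comp _ _ (cL p) (@continuous_enorm R k (L p))).
Qed.

Let zeta_sum z : \sum_(i < k.+1) zeta z i + zeta z k.+1 = 0.
Proof.
rewrite {2}/zeta ltnn (eq_bigr (fun i => z 0 i)) ?subrr // => i _.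
by rewrite /zeta ltn_ord inord_val.
Qed.

Let m_ge z i : (i < k.+2)%N -> - zeta z i <= m z.
Proof. by move=> ik; exact: (le_bigmax 0 (fun i : 'I_k.+2 => - zeta z i) (Ordinal ik)). Qed.

(** A non-zero displacement whose coordinates sum to zero has a negative coordinate. *)
Let m_gt0 z : sphere z -> 0 < m z.
Proof.
move=> /sphereE z1; rewrite ltNge; apply/negP => m0.
have z0 i : (i < k.+2)%N -> 0 <= zeta z i.
  by move=> /(m_ge z) /le_trans /(_ m0); rewrite oppr_le0.
have zl : zeta z k.+1 <= 0.
  have : 0 <= \sum_(i < k.+1) zeta z i.
    by apply: sumr_ge0 => i _; apply: z0; rewrite ltnS ltnW.
  by have := zeta_sum z; lra.
have S0 : \sum_(i < k.+1) zeta z i = 0.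
  by have := zeta_sum z; have := z0 _ (ltnSn k.+1); lra.
have : z = 0.
  apply/rowP => i; rewrite mxE.
  have /eqP := S0; rewrite psumr_eq0; last by move=> j _; apply: z0; rewrite ltnS ltnW.
  move=> /allP /(_ i (mem_index_enum i)) /=.
  by rewrite /zeta ltn_ord inord_val => /eqP.
by move/eqP; rewrite -enorm_eq0 z1 oner_eq0.
Qed.

Let of_sphere_coord z i : (i < k.+2)%N ->
  of_sphere z (a i) = c * (1 + zeta z i / m z).
Proof.
move=> ik; rewrite /of_sphere free_coord_sum (bigD1 (Ordinal ik)) //=.
rewrite big1 ?addr0 => [|j ji].
  by rewrite -[LHS]/(c * (1 + zeta z i / m z) * (a i == a i)%:R) eqxx mulr1.
rewrite -[LHS]/(c * (1 + zeta z j / m z) * (a i == a j)%:R).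
rewrite nth_uniq ?sizes ?fset_uniq //.
by move: ji; rewrite -val_eqE /= eq_sym => /negbTE ->; rewrite mulr0.
Qed.

Let of_sphere_boundary z : sphere z -> simplex_boundary (of_sphere z).
Proof.
move=> sz; have m0 := m_gt0 sz; split.
  apply: std_simplex_combination => [i _|i _ _|].
  - rewrite mulr_ge0 ?(ltW c_gt0) // -(mulfV (lt0r_neq0 m0)) -mulrDl.
    rewrite divr_ge0 ?(ltW m0) //; have := m_ge z (ltn_ord i); lra.
  - exact: as_.
  - rewrite -big_distrr big_split /= sumr_const card_ord -mulr_natl mulr1.
    rewrite -big_distrl /= big_ord_recr /= zeta_sum mul0r addr0.
    by rewrite /c mulVf // pnatr_eq0.
have [i ik zi] : exists2 i, (i < k.+2)%N & - zeta z i = m z.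
  apply: contrapT => nz; suff : m z < m z by rewrite ltxx.
  apply/bigmax_ltP; split=> // i _.
  rewrite lt_neqAle m_ge // andbT; apply/eqP => zi; apply: nz; by exists i.
exists (a i); first exact: as_.
by rewrite of_sphere_coord // -zi invrN mulrN mulfV ?subrr ?mulr0 // -oppr_eq0 zi gt_eqF.
Qed.

Let continuous_of_sphere z : sphere z -> {for z, continuous of_sphere}.
Proof.
move=> sz; have m0 := m_gt0 sz.
have czeta i : continuous (zeta ^~ i).
  have [ik|ik] := boolP (i < k.+1)%N.
    have -> : zeta^~ i = fun z => z 0 (inord i).
      by apply/funext => y; rewrite /zeta ik.
    exact: coord_continuous.
  have -> : zeta^~ i = fun z => - \sum_j z 0 j.
    by apply/funext => y; rewrite /zeta (negbTE ik).
  move=> y; rewrite /continuous_at; have FF : Filter (nbhs y) by exact: nbhs_filter.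
  apply: cvgN; apply: cvg_big => [|j _]; first exact: add_continuous.
  exact: coord_continuous.
rewrite /continuous_at; have FF : Filter (nbhs z) by exact: nbhs_filter.
apply: cvg_free_sum => i; apply: cvgM; first exact: cvg_cst.
apply: cvgD; first exact: cvg_cst.
apply: cvgM; first exact: czeta.
apply: cvgV; first by rewrite gt_eqF.
have cm : {for z, continuous m}.
  apply: (@continuous_bigmax R _ _ (index_enum 'I_k.+2) (fun i z => - zeta z i)) => j.
  by rewrite /prop_for /continuous_at; apply: cvgN; exact: czeta.
exact: cm.
Qed.

(** On the boundary [mu p = 0] and the least coordinate of [p] is 0, so [m (to_ball p)] equals
    [c / enorm (L p)] and the ray leaves the simplex exactly at [p]. *)
Let of_sphere_to_ball p : simplex_boundary p -> of_sphere (to_ball p) = p.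
Proof.
move=> bp; have [sp [v vs pv]] := bp; have [p0 ps p1] := sp.
have := denom_gt0 sp; rewrite mu_boundary // addr0 => e0.
have zE i : (i < k.+2)%N -> zeta (to_ball p) i = (p (a i) - c) / enorm (L p).
  rewrite ltnS leq_eqVlt => /orP[/eqP ->|ik]; rewrite /zeta ?ltnn ?ik; last first.
    by rewrite /to_ball mu_boundary // addr0 !mxE inordK // mulrC.
  rewrite (eq_bigr (fun j : 'I_k.+1 => (p (a j) - c) / enorm (L p))) => [|j _]; last first.
    by rewrite /to_ball mu_boundary // addr0 !mxE mulrC.
  rewrite -big_distrl /= -mulNr sumrB sumr_const card_ord -mulr_natl; congr (_ / _).
  by move: p1 kc; rewrite sumsE; move: (_ * c) => d; lra.
have mE : m (to_ball p) = c / enorm (L p).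
  apply/eqP; rewrite eq_le; apply/andP; split.
    apply/bigmax_leP; split; first by rewrite divr_ge0 // ltW.
    move=> i _; rewrite zE // -mulNr ler_pM2r ?invr_gt0 //.
    by have := p0 (a i); lra.
  have [i ik vi] := indexs vs.
  apply: le_trans (m_ge _ ik); rewrite zE // -vi pv sub0r mulNr opprK lexx.
  by [].
rewrite [RHS](free_vertex_sum ps) (big_nth v0) big_mkord sizes.
apply: eq_bigr => i _; congr (_ *: _).
rewrite zE // mE -/(a i); field.
by rewrite !gt_eqF.
Qed.

(** [of_sphere] carries the boundary data to the sphere and [to_ball] pulls the extension back; they
    match by [of_sphere_to_ball]. The compact image [K] is recorded because lower local constancy
    speaks of compact sets. *)
Lemma extend_boundary (Y : topologicalType) (A B : set Y) (g : E -> Y) :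
  @sphere_extends Y R k A B -> {within simplex_boundary, continuous g} ->
  g @` simplex_boundary `<=` A ->
  exists G : E -> Y, [/\ {within std_simplex s, continuous G},
    forall p, simplex_boundary p -> G p = g p &
    exists K, [/\ compact K, K `<=` B & G @` std_simplex s `<=` K]].
Proof.
move=> AB cg gA.
have [||h [ch hB hg]] := AB (g \o of_sphere).
- exact: (within_continuous_comp of_sphere_boundary continuous_of_sphere cg).
- move=> _ [z sz <-]; apply: gA; exists (of_sphere z) => //.
  exact: of_sphere_boundary.
exists (h \o to_ball); split.
- exact: (within_continuous_comp to_ball_le1 continuous_to_ball ch).
- move=> p bp /=; rewrite hg; first by rewrite /= of_sphere_to_ball.
  exact: to_ball_boundary.
- exists (h @` (@solid_ball R k)); split=> //.
    by apply: continuous_compact => //; exact: compact_solid_ball.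
  by move=> _ [p sp <-]; exists (to_ball p) => //; exact: to_ball_le1.
Qed.

End extend_boundary.

Lemma within_continuous_closed_cover (X Y : topologicalType) (I : choiceType)
    (D : {fset I}) (F : I -> set X) (f : X -> Y) :
  (forall i, i \in D -> closed (F i)) ->
  (forall i, i \in D -> {within F i, continuous f}) ->
  {within \bigcup_(i in [set` D]) F i, continuous f}.
Proof.
move=> cF fF; rewrite -bigsetU_fset_set // set_fsetK big_seq.
pose P (A : set X) := closed A /\ {within A, continuous f}.
suff [] : P (\big[setU/set0]_(i <- D | i \in D) F i) by [].
elim/big_ind : _ => [|A B [cA fA] [cB fB]|i iD].
- by split; [exact: closed0|exact: continuous_subspace0].
- by split; [exact: closedU|exact: withinU_continuous].
- by split; [exact: cF|exact: fF].
Qed.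

(** * Coning off a family of simplices from a new vertex *)

Section cone_extension.
Variables (R : realType) (V : choiceType) (Y : topologicalType).
Variables (B : nat -> set Y) (S : set {fset V}) (w : V) (y0 : Y).
Local Notation E := (free_space R V).
Variable h : E -> Y.
Hypothesis By0 : B 0%N y0.
Hypothesis BS : forall d, @sphere_extends Y R d (B d) (B d.+1).
Hypothesis Ssub : forall s t : {fset V}, S s -> {subset t <= s} -> S t.
Hypothesis Sw : forall s, S s -> w \notin s.
Hypothesis hS : forall s, S s -> s != fset0 ->
  {within std_simplex s, continuous h} /\ h @` std_simplex s `<=` B #|` s|.-1.

(** Induction on the number of vertices of the base. For [s] with [d.+1] vertices, the boundary of
    the cone consists of [s], which [h] maps into [B d], and of the cones over its facets, which go
    into [B d] by induction; [BS] then fills the cone inside [B d.+1]. *)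
Lemma cone_extension (d : nat) : exists H : E -> Y,
  (forall p : E, p w = 0 -> H p = h p) /\
  forall s, S s -> (#|` s| <= d)%N ->
    {within std_simplex (w |` s)%fset, continuous H} /\
    exists K, [/\ compact K, K `<=` B #|` s| &
      H @` std_simplex (w |` s)%fset `<=` K].
Proof.
elim: d => [|d [H [Hh HS]]].
  (* Over the empty base the cone is the apex alone, which is sent to [y0]. *)
  exists (fun p : E => if p w == 0 then h p else y0); split=> [p ->|s Ss].
    by rewrite eqxx.
  rewrite leqn0 cardfs_eq0 => /eqP ->; rewrite fsetU0.
  have Hy (p : E) : std_simplex [fset w]%fset p -> (if p w == 0 then h p else y0) = y0.
    move=> [_ _]; rewrite big_seq_fset1 => ->; by rewrite oner_eq0.
  split.
    apply: (@subspace_eq_continuous _ _ _ (fun=> y0)).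
      by move=> p; rewrite inE => sp; exact: (esym (Hy _ sp)).
    exact: cst_continuous.
  exists [set y0]; split.
  - exact: compact_set1.
  - by rewrite cardfs0 => _ ->.
  - by move=> _ [p /Hy -> <-].
(* The vertex set of the smallest base whose cone contains [p]. *)
pose sig (p : E) := fset_set [set v | p v != 0 /\ v != w].
have sigE p v : (v \in sig p) = (p v != 0) && (v != w).
  have /Defs.finsuppP fp := free_valP p.
  rewrite in_fset_set; last by apply: sub_finite_set fp => u [].
  by apply/idP/andP; rewrite inE.
have sig_sub s p : std_simplex (w |` s)%fset p -> {subset sig p <= s}.
  move=> [_ ps _] v; rewrite sigE => /andP[/ps]; rewrite !inE.
  by case: (v == w).
have bdS s : S s -> #|` s| = d.+1 ->
    {within simplex_boundary (w |` s)%fset, continuous H} /\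
    H @` @simplex_boundary R V (w |` s)%fset `<=` B d.
  move=> Ss sd.
  have s0 : s != fset0 by rewrite -cardfs_gt0 sd.
  have [ch hB] := hS Ss s0.
  have facesS v : v \in s -> S (s `\ v)%fset /\ #|` (s `\ v)%fset| = d.
    move=> vs; split; first by apply: Ssub Ss _ => u; rewrite !inE => /andP[].
    by move: sd; rewrite (cardfsD1 v) vs add1n => -[].
  pose F v := if v == w then std_simplex s else std_simplex (w |` (s `\ v))%fset : set E.
  have bdE : @simplex_boundary R V (w |` s)%fset `<=` \bigcup_(v in [set` (w |` s)%fset]) F v.
    move=> p [sp [v vs pv]]; exists v => //; rewrite /F.
    case: eqP => [vw|/eqP vw].
      apply: (std_simplexW sp) => u pu; case: sp => _ /(_ u pu) + _.
      by rewrite !inE => /orP[/eqP uw|//]; rewrite uw -vw pv eqxx in pu.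
    apply: (std_simplexW sp) => u pu; case: sp => _ /(_ u pu) + _.
    rewrite !inE => /orP[->//|us]; rewrite us andbT.
    by apply/orP; right; apply: contraNneq pu => ->; rewrite pv.
  have FH v : v \in (w |` s)%fset -> {within F v, continuous H} /\ H @` F v `<=` B d.
    rewrite /F !inE; case: eqP => [_ _|_ /= vs].
      have Hw p : std_simplex s p -> H p = h p.
        move=> [_ ps _]; apply: Hh; apply/eqP; apply: contrapT => /negP /ps.
        by rewrite (negbTE (Sw Ss)).
      split.
        by apply: (@subspace_eq_continuous _ _ _ h) => // p; rewrite inE => sp; exact: (esym (Hw _ sp)).
      move=> _ [p sp <-]; rewrite Hw //; move: hB; rewrite sd /=; apply.
      by exists p.
    have [Sv cv] := facesS v vs; have [|cH [K [_ KB HK]]] := HS _ Sv.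
      by rewrite cv.
    by split=> //; apply: subset_trans HK _; rewrite cv in KB.
  split; last first.
    move=> _ [p bp <-]; have [v vs Fp] := bdE p bp.
    by have [_] := FH v vs; apply; exists p.
  apply: continuous_subspaceW bdE _.
  apply: within_continuous_closed_cover => v vs; last by have [] := FH v vs.
  by rewrite /F; case: ifP => _; exact: closed_std_simplex.
have /choice[G HG] : forall s, exists G : E -> Y, S s -> #|` s| = d.+1 ->
    [/\ {within std_simplex (w |` s)%fset, continuous G},
    forall p, simplex_boundary (w |` s)%fset p -> G p = H p &
    exists K, [/\ compact K, K `<=` B d.+1 & G @` std_simplex (w |` s)%fset `<=` K]].
  move=> s; have [[Ss sd]|ns] := pselect (S s /\ #|` s| = d.+1); last first.
    by exists h => Ss sd; case: ns.
  have cs : #|` (w |` s)%fset| = d.+2 by rewrite cardfsU1 (Sw Ss) sd.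
  have [cH HB] := bdS s Ss sd.
  by have [G ?] := extend_boundary w cs (BS (d := d)) cH HB; exists G.
(* Only points interior to a cone with [d.+1] base vertices are redefined; as [G s] agrees with [H]
   on the boundary, the new map is [G s] on the whole cone over [s]. *)
pose H' (p : E) := if [&& p w != 0, #|` sig p| == d.+1 & `[< S (sig p) >]]
  then G (sig p) p else H p.
exists H'; split=> [p pw|s Ss].
  by rewrite /H' pw eqxx /= Hh.
rewrite leq_eqVlt => /orP[/eqP sd|].
  have [cG GH [K [cK KB GK]]] := HG s Ss sd.
  have H'G p : std_simplex (w |` s)%fset p -> H' p = G s p.
    move=> sp; have subs := sig_sub s p sp.
    have [sE|sE] := eqVneq (sig p) s.
      have [pw|pw] := eqVneq (p w) 0; last first.
        by rewrite /H' pw sE sd eqxx asboolT.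
      rewrite /H' pw eqxx /= GH //; split=> //; exists w => //.
      by rewrite !inE eqxx.
    have nsig : #|` sig p| != d.+1.
      apply: contra sE => /eqP csig; rewrite eqEfcard csig sd leqnn andbT.
      exact/fsubsetP.
    rewrite /H' (negbTE nsig) andbF GH //; split=> //.
    apply: contrapT => nv; move/negP: sE; apply.
    rewrite eqEfsubset; apply/andP; split; apply/fsubsetP => // v vs.
    rewrite sigE; apply/andP; split.
      by apply/eqP => pv; apply: nv; exists v => //; rewrite !inE vs orbT.
    by apply: contraTneq vs => ->; exact: Sw.
  split.
    apply: (@subspace_eq_continuous _ _ _ (G s)) => // p.
    by rewrite inE => sp; exact: (esym (H'G _ sp)).
  exists K; split=> //; first by rewrite sd.
  by move=> _ [p sp <-]; rewrite H'G //; apply: GK; exists p.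
rewrite ltnS => sd; have [cH [K [cK KB HK]]] := HS s Ss sd.
have H'H p : std_simplex (w |` s)%fset p -> H' p = H p.
  move=> sp; have /fsubset_leq_card csig : (sig p `<=` s)%fset.
    by apply/fsubsetP; exact: sig_sub.
  rewrite /H'; have -> : (#|` sig p| == d.+1) = false.
    by apply/negbTE; rewrite neq_ltn ltnS (leq_trans csig).
  by rewrite andbF.
split.
  apply: (@subspace_eq_continuous _ _ _ H) => // p.
  by rewrite inE => sp; exact: (esym (H'H _ sp)).
by exists K; split=> //; move=> _ [p sp <-]; rewrite H'H //; apply: HK; exists p.
Qed.

End cone_extension.

(** * Selections in finite C-spaces *)

Section finite_C_selection.
Variables (R : realType) (X Y : topologicalType).
Hypotheses (pcX : paracompact X) (hdX : hausdorff_space X).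
Variable phi : nat -> X -> set Y.
Hypothesis phi0 : forall k x, phi k x !=set0.
Hypothesis llc : forall k, lower_locally_constant (phi k).
Hypothesis asph : aspherical R phi.
Local Notation T := (X * nat)%type.
Local Notation E := (free_space R T).
Implicit Types (U : nat -> X -> set X) (s t : {fset T}).

(** A constant map on the sphere extends into the next set, and the extension still takes the
    constant value at a point of the sphere. *)
Lemma aspherical_sub j k x : (j <= k)%N -> phi j x `<=` phi k x.
Proof.
elim: k => [|k IH]; first by rewrite leqn0 => /eqP ->.
rewrite leq_eqVlt => /orP[/eqP -> //|]; rewrite ltnS => /IH jk y /jk phiy.
pose z : 'rV[R]_k.+1 := \row_i (i == 0)%:R.
have sz : sphere z.
  rewrite /sphere /= (bigD1 0) //= big1 ?addr0 => [|i /negbTE i0].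
    by rewrite mxE eqxx expr1n.
  by rewrite mxE i0 expr0n.
have [||h [_ hB hg]] := asph (k := k) (x := x) (g := fun=> y).
- by move=> ?; exact: cst_continuous.
- by move=> _ [? _ <-].
rewrite -(hg z sz); apply: hB; exists z => //.
by apply/solid_ballE; rewrite (proj1 (sphereE z) sz).
Qed.

(* The vertex [(a, k)] stands for the member [U k a] of the [k]-th cover. *)
Definition transversal_simplex k U x : set {fset T} := [set s : {fset T} |
  (forall v, v \in s -> (v.2 < k)%N /\ closure (U v.2 v.1) x) /\
  (forall v w, v \in s -> w \in s -> v.2 = w.2 -> v = w)].

(** [h] is a single map on the free space, continuous on each simplex separately. A simplex with
    [d.+1] vertices at [x] goes into [phi d x], an index that asphericity raises by one with each
    new vertex. *)
Definition partial_selection k U (h : E -> Y) :=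
  (forall i, (i < k)%N -> [/\ forall a, open (U i a), forall x, exists a, U i a x &
     locally_finite_indexed (U i)]) /\
  (forall x s, transversal_simplex k U x s -> s != fset0 ->
     {within std_simplex s, continuous h} /\
     h @` std_simplex s `<=` phi #|` s|.-1 x).

(** The new cover is indexed by the points of [X], with [(x, k)] the apex of cones over all
    transversal simplices at [x]. By local finiteness there are finitely many of these, so one
    neighbourhood serves them all. *)
Lemma partial_selection_step k U h : partial_selection k U h ->
  exists U' h', partial_selection k.+1 U' h' /\
    forall i, (i < k)%N -> U' i = U i.
Proof.
move=> [HU Hh].
have finN x : finite_set [set v : T | (v.2 < k)%N /\ closure (U v.2 v.1) x].
  apply: (@sub_finite_set _ _ (\bigcup_(j in `I_k)
      ((fun a => (a, j)) @` [set a | closure (U j a) x]))).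
    by move=> [a j] /= [jk cl]; exists j => //; exists a.
  apply: bigcup_finite => [|j jk]; first exact: finite_II.
  apply: finite_image; have [_ _ lfU] := HU j jk.
  have [N nN finN] := lfU x; apply: sub_finite_set finN => a cl /=.
  by have [y [Uy Ny]] := cl N nN; exists y.
pose N x := fset_set [set v : T | (v.2 < k)%N /\ closure (U v.2 v.1) x].
have NE x v : v \in N x -> (v.2 < k)%N /\ closure (U v.2 v.1) x.
  by rewrite in_fset_set // inE.
have subN x s : transversal_simplex k U x s -> {subset s <= N x}.
  by move=> [s1 _] v /s1 ?; rewrite in_fset_set // inE.
have /choice[H HH] : forall x, exists H : E -> Y,
    (forall p : E, p (x, k) = 0 -> H p = h p) /\
    forall s, transversal_simplex k U x s ->
      {within std_simplex ((x, k) |` s)%fset, continuous H} /\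
      exists K, [/\ compact K, K `<=` phi #|` s| x &
        H @` std_simplex ((x, k) |` s)%fset `<=` K].
  move=> x; have [y0 phiy0] := phi0 0%N x.
  have [||||H [Hh' HS]] := @cone_extension R T Y (phi ^~ x)
      (transversal_simplex k U x) (x, k) y0 h phiy0 _ _ _ _ #|` N x|.
  - by move=> d; exact: asph.
  - by move=> s t [s1 s2] ts; split=> [v /ts/s1|v w /ts vs /ts ws] //; exact: s2.
  - by move=> s [s1 _]; apply/negP => /s1[/=]; rewrite ltnn.
  - by move=> s Ss s0; exact: Hh.
  exists H; split=> // s Ss; apply: HS => //.
  by apply: fsubset_leq_card; apply/fsubsetP; exact: subN.
(* Two demands on [z]: a simplex transversal at [z] is transversal at [x], and the cones built at
   [x] have values allowed at [z]. With closures in the first demand, both hold on a neighbourhood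
   of [x]. *)
pose O x : set X := [set z |
  (forall v : T, (v.2 < k)%N -> closure (U v.2 v.1) z -> closure (U v.2 v.1) x) /\
  forall s, transversal_simplex k U x s ->
    H x @` std_simplex ((x, k) |` s)%fset `<=` phi #|` s| z].
have nO x : nbhs x (O x).
  have n1 : nbhs x (\bigcap_(i in [set` fset_set `I_k])
      ~` closure (\bigcup_(a in [set a | ~ closure (U i a) x]) U i a)).
    apply: filter_bigI => i; rewrite in_fset_set; last exact: finite_II.
    rewrite inE /= => ik; apply: open_nbhs_nbhs; split.
      by rewrite openC; exact: closed_closure.
    have [_ _ lfU] := HU i ik.
    by move=> /(closure_bigcup_locally_finite lfU)[a /= ncl cl].
  have n2 : nbhs x (\bigcap_(s in [set` fpowerset (N x)])
      [set z | transversal_simplex k U x s ->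
        H x @` std_simplex ((x, k) |` s)%fset `<=` phi #|` s| z]).
    apply: filter_bigI => s _.
    have [Ss|nS] := pselect (transversal_simplex k U x s); last first.
      by apply: filterS filterT => z _ /nS.
    have [_ /(_ s Ss)[_ [K [cK KB HK]]]] := HH x.
    have : nbhs x [set z | K `<=` phi #|` s| z].
      by apply: open_nbhs_nbhs; split; [exact: llc|].
    by apply: filterS => z Kz _; exact: subset_trans HK Kz.
  apply: filterS2 n1 n2 => z z1 z2; split.
    move=> v vk clz; apply: contrapT => nclx.
    apply: (z1 v.2); first by rewrite /= in_fset_set ?inE //; exact: finite_II.
    by apply: closureS clz => y Uy; exists v.1.
  move=> s Ss; apply: (z2 s) => //=; rewrite fpowersetE; apply/fsubsetP.
  exact: subN.
have [||G [oG GO cG lfG]] := @paracompact_shrinking X pcX hdX X (fun x => (O x)°).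
- by move=> x; exact: open_interior.
- by move=> x; exists x; exact: nO.
pose U' i := if i == k then G else U i.
(* A transversal simplex has at most one vertex of level [k], so on it the choice of [a] is
   forced. *)
pose h' (p : E) := if pselect (exists a, p (a, k) != 0) is left e
  then H (sval (cid e)) p else h p.
exists U', h'; split; last by move=> i ik; rewrite /U' ltn_eqF.
split=> [i|z s [s1 s2] s0].
  rewrite ltnS leq_eqVlt /U'; case: eqP => [_ _|_ /= ik]; last exact: HU.
  by split.
have [[a aks]|nk] := pselect (exists a, (a, k) \in s); last first.
  have Ss : transversal_simplex k U z s.
    split=> // v vs; have [] := s1 v vs; rewrite ltnS leq_eqVlt /U'.
    case: eqP => //= vk; case: nk; exists v.1; by rewrite -vk -surjective_pairing.
  have h'h p : std_simplex s p -> h' p = h p.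
    move=> [_ ps _]; rewrite /h'; case: pselect => // -[a pa].
    by case: nk; exists a; exact: ps.
  have [ch hphi] := Hh z s Ss s0; split.
    apply: (@subspace_eq_continuous _ _ _ h) => // p.
    by rewrite inE => sp; exact: (esym (h'h _ sp)).
  by move=> _ [p sp <-]; rewrite h'h //; apply: hphi; exists p.
pose s' := (s `\ (a, k))%fset.
have sE : s = ((a, k) |` s')%fset by rewrite fsetD1K.
have Oz : O a z.
  have [_ Gz] := s1 _ aks; rewrite /U' /= eqxx in Gz.
  exact: interior_subset (GO a z Gz).
have Ss' : transversal_simplex k U a s'.
  split=> [v|v w]; last by rewrite !inE => /andP[_ vs] /andP[_ ws]; exact: s2.
  rewrite !inE => /andP[va vs].
  have vk : v.2 != k.
    by apply: contra va => /eqP vk; apply/eqP; exact: s2.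
  have [] := s1 v vs; rewrite ltnS leq_eqVlt /U' (negbTE vk) /= => vk' cl.
  by split=> //; have [+ _] := Oz; apply.
have h'H p : std_simplex s p -> h' p = H a p.
  move=> [_ ps _]; rewrite /h'; case: pselect => [e|ne]; last first.
    have [Ha _] := HH a; rewrite Ha //; apply/eqP; apply: contrapT => /negP pa.
    by apply: ne; exists a.
  case: (cid e) => b /= pb; have [->//] : (b, k) = (a, k) by apply: s2 => //; exact: ps.
have cs : #|` s|.-1 = #|` s'| by rewrite (cardfsD1 (a, k)) aks.
have [_ /(_ s' Ss')[]] := HH a; rewrite -sE => cH _; split.
  apply: (@subspace_eq_continuous _ _ _ (H a)) => // p.
  by rewrite inE => sp; exact: (esym (h'H _ sp)).
move=> _ [p sp <-]; rewrite h'H // cs.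
have [_ /(_ s' Ss')] := Oz; rewrite -sE; apply; by exists p.
Qed.

Lemma finite_C_selection : finite_C_space X ->
  exists (n : nat) (f : X -> Y), continuous f /\ selection (phi n) f.
Proof.
move=> finC.
(* Over an empty [X] there may be no point of [Y] with which to start. *)
have [[x0 _]|noX] := pselect (exists x : X, True); last first.
  have nX (x : X) : False by apply: noX; exists x.
  by exists 0%N, (fun x => False_rect Y (nX x)); split=> [x|x]; case: (nX x).
have [y0 _] := phi0 0%N x0.
(* The step is made total so that it can be iterated: a pair violating the invariant is returned
   unchanged. *)
have /choice[F HF] : forall kst : nat * ((nat -> X -> set X) * (E -> Y)),
    exists st : (nat -> X -> set X) * (E -> Y),
    partial_selection kst.1 kst.2.1 kst.2.2 ->
    partial_selection kst.1.+1 st.1 st.2 /\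
    forall i, (i < kst.1)%N -> st.1 i = kst.2.1 i.
  move=> [k [U h]] /=.
  have [/partial_selection_step[U' [h' H']]|nps] := pselect (partial_selection k U h).
    by exists (U', h').
  by exists (U, h).
pose st := fix st k : (nat -> X -> set X) * (E -> Y) :=
  if k is k'.+1 then F (k', st k') else ((fun _ _ => set0), fun=> y0).
have Hst k : partial_selection k (st k).1 (st k).2.
  elim: k => [|k IH]; last by have [] := HF (k, st k) IH.
  split=> // x s [s1 _] /fset0Pn[v /s1[]].
  by rewrite ltn0.
have stS k i : (i < k)%N -> (st k.+1).1 i = (st k).1 i.
  by move=> ik; have [_] := HF (k, st k) (Hst k); apply.
(* The diagonal sequence of covers; a cover is never altered after the stage that creates it. *)
pose Uc i := (st i.+1).1 i.
have stUc k i : (i < k)%N -> (st k).1 i = Uc i.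
  elim: k => [//|k IH]; rewrite ltnS leq_eqVlt => /orP[/eqP -> //|ik].
  by rewrite stS // IH.
have HUc i : [/\ forall a, open (Uc i a), forall x, exists a, Uc i a x &
    locally_finite_indexed (Uc i)].
  by have [/(_ i (ltnSn i))] := Hst i.+1.
have [k|n [Q [dQ cQ]]] := @finite_C_disjointly_refines R X pcX hdX
    (fun k => range (Uc k)) finC.
  have [oU cU _] := HUc k; split; first by move=> _ [a _ <-].
  by apply/seteqP; split=> // x _; have [a Ux] := cU x; exists (Uc k a) => //; exists a.
have /choice[l Hl] := fun k => disjointly_refines_label (dQ k).
have /choice[ind Hind] : forall kA : nat * set X, exists a, range (Uc kA.1) kA.2 -> Uc kA.1 a = kA.2.
  move=> [k A] /=; have [[a _ <-]|nr] := pselect (range (Uc k) A); first by exists a.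
  by exists x0.
have [|||p [cp Hp]] := @canonical_partition R X pcX hdX T n Q
    (fun k x => (ind (k, l k x), k)).
- by move=> k; exact: disjointly_refines_open (dQ k).
- exact: cQ.
- by move=> k x /Hl[_ _]; apply: filterS => z ->.
have [_ Hh] := Hst n.+1.
have Hs x s : (forall v, v \in s -> exists k, [/\ (k <= n)%N, Q k x & v = (ind (k, l k x), k)]) ->
    transversal_simplex n.+1 (st n.+1).1 x s.
  move=> sQ; split=> [v /sQ[k [kn /Hl[Ul lx _] ->]]|v w].
    split=> //; have : closure (Uc k (ind (k, l k x))) x.
      by apply: subset_closure; have -> := Hind (k, l k x) Ul.
    by rewrite -(stUc n.+1 k kn).
  by move=> /sQ[k [_ _ ->]] /sQ[k' [_ _ ->]] /= ->.
have s0 s z : std_simplex s (p z) -> s != fset0.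
  move=> [_ _ p1]; apply/eqP => s0; move: p1; rewrite s0 big_nil => /eqP.
  by rewrite eq_sym oner_eq0.
exists n, ((st n.+1).2 \o p); split=> x; have [s [near_s sQ]] := Hp x.
  have sp := nbhs_singleton near_s.
  have [/subspace_continuousP ch _] := Hh x s (Hs x s sQ) (s0 s x sp).
  rewrite /continuous_at; apply: (@cvg_comp _ _ _ p (st n.+1).2 _ _ _ _ (ch _ sp)).
  move=> W /= wW; have : \forall z \near x, std_simplex s (p z) -> W (p z).
    exact: (cp x _ wW).
  by apply: filterS2 near_s => z sz; apply.
have sp := nbhs_singleton near_s.
have [_ hphi] := Hh x s (Hs x s sQ) (s0 s x sp).
(* The vertices of [s] come from the levels 0, ..., [n], one for each at most, so [s] has at most
   [n.+1] vertices and the index reached is at most [n]. *)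
apply: (@aspherical_sub #|` s|.-1); last by apply: hphi; exists (p x).
rewrite -ltnS prednK; last by rewrite cardfs_gt0; exact: s0 sp.
have /fsubset_leq_card : (s `<=` [fset (ind (k, l k x), k) | k in iota 0 n.+1])%fset.
  apply/fsubsetP => v /sQ[k [kn _ ->]]; apply/imfsetP; exists k => //.
  by rewrite inE mem_iota; case: k kn.
move=> /leq_trans; apply; apply: leq_trans (leq_imfset_card _ _ _) _.
by apply: leq_trans (size_undup (iota 0 n.+1)) _; rewrite size_iota.
Qed.

End finite_C_selection.

Theorem corollary6p3 (R : realType) (X : topologicalType)
    (X_paracompact : paracompact X) (X_hausdorff : hausdorff_space X) :
  let a := finite_C_space X in
  let b := forall (Y : topologicalType) (phi : nat -> X -> set Y),
    hausdorff_space Y ->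
    (forall k x, phi k x !=set0) ->
    (forall k, lower_locally_constant (phi k)) ->
    aspherical R phi ->
    exists (n : nat) (f : X -> Y), continuous f /\ selection (phi n) f in
  let c := forall U : nat -> set (set X),
    (forall k, open_cover (U k)) ->
    exists (n : nat) (f : X -> Delta_space R U n), canonical_map f in
  (a <-> b) /\ (b <-> c).
Proof.
move=> a b c.
have ab : a -> b.
  by move=> finC Y phi _ phi0 llc asph; exact: (finite_C_selection X_paracompact X_hausdorff phi0 llc asph finC).
have ba : b -> a by exact: (selection_finite_C X_paracompact X_hausdorff).
have ac : a -> c by move=> finC U oU; exact: finite_C_canonical_map.
have ca : c -> a by exact: (canonical_map_finite_C X_paracompact X_hausdorff).
by split; split=> // [/ba/ac|/ca/ab].
Qed.
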